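(* Let $M_0$ be an r-framed, 2-ruled, special Lagrangian cone in $\mathbb{C}^4\cong\mathbb{R}^8$ defined by $\phi_1,\phi_2:\Sigma\to\mathcal{S}^7$ in the flat gauge, where $\Sigma$ is a Riemann surface. Let $w$ be a holomorphic vector field on $\Sigma$ and define $\psi:\Sigma\to\mathbb{C}^4$ by $\psi=\mathcal{L}_w\phi_1+\mathcal{L}_{iw}\phi_2$, where $\mathcal{L}_w,\mathcal{L}_{iw}$ denote the Lie derivatives with respect to $w,iw$. Let $$M=\{r_1\phi_1(\sigma)+r_2\phi_2(\sigma)+\psi(\sigma):r_1,r_2\in\mathbb{R},\ \sigma\in\Sigma\}.$$ Then $M$ is an r-framed 2-ruled Cayley 4-fold in $\mathbb{R}^8$, which is special Lagrangian if and only if $w\equiv0$ or there exists $\theta\in\mathbb{R}$ for each component $K$ of $\Sigma$ such that $\cos\theta\,\phi_1+\sin\theta\,\phi_2$ is constant on $K$.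
   Context: Identify $\mathbb{R}^8\cong\mathbb{C}^4$ by $z_1=x_1+ix_2$, $z_2=x_3+ix_4$, $z_3=x_5+ix_6$, $z_4=x_7+ix_8$, with Euclidean metric $g$. Let $\omega=\frac{i}{2}\sum_{j=1}^4dz_j\wedge d\bar z_j$, $\Omega=dz_1\wedge dz_2\wedge dz_3\wedge dz_4$ and $\Phi=\frac12\omega\wedge\omega+\operatorname{Re}\Omega$. A 4-dimensional submanifold of $\mathbb{R}^8$ is Cayley (respectively special Lagrangian) if, for a suitable orientation, $\Phi$ (respectively $\operatorname{Re}\Omega$) restricts to the Riemannian volume form on each of its tangent spaces. The triple cross product on $\mathbb{R}^8$ is defined by $g(x\times y\times z,v)=\Phi(x,y,z,v)$ for all $v$. A 2-ruled 4-fold is an (immersed) 4-dimensional submanifold with a smooth map to a 2-manifold $\Sigma$ whose fibres are affine 2-planes; it is r-framed if an oriented orthonormal basis $(\phi_1(\sigma),\phi_2(\sigma))$ of (the direction of) each fibre is chosen, varying smoothly with $\sigma$. The set $M$ above is the image of $\iota_M(r_1,r_2,\sigma)=r_1\phi_1(\sigma)+r_2\phi_2(\sigma)+\psi(\sigma)$ on $\mathbb{R}^2\times\Sigma$, and may have singularities (points where $\iota_M$ is not an immersion). A cone is a submanifold invariant under dilations and nonsingular except possibly at $0$. The r-framed 2-ruled cone defined by orthogonal maps $\phi_1,\phi_2:\Sigma\to\mathcal{S}^7$ is $M_0=\{r_1\phi_1(\sigma)+r_2\phi_2(\sigma):\sigma\in\Sigma,\ r_1,r_2\in\mathbb{R}\}$,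 where the map $\iota:\Sigma\times\mathcal{S}^1\to\mathcal{S}^7$, $\iota(\sigma,e^{i\theta})=\cos\theta\,\phi_1(\sigma)+\sin\theta\,\phi_2(\sigma)$, is an immersion, so that $M_0$ is nonsingular except at $0$. The complex structure of $\Sigma$ is the one determined by $M_0$: together with the flat gauge condition this means that for local holomorphic coordinates $s+it$ on $\Sigma$, $$\frac{\partial\phi_j}{\partial t}=\phi_1\times\phi_2\times\frac{\partial\phi_j}{\partial s},\qquad \frac{\partial\phi_j}{\partial s}=-\phi_1\times\phi_2\times\frac{\partial\phi_j}{\partial t}\qquad (j=1,2).$$ A holomorphic vector field $w$ is regarded as a real vector field: locally $w=u\,\partial_s+v\,\partial_t$ with $u+iv$ holomorphic in $s+it$, and $iw=-v\,\partial_s+u\,\partial_t$. *)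

(* Defs.v *)
From HB Require Import structures.
From mathcomp Require Import all_boot all_order all_algebra.
From mathcomp Require Import all_classical all_reals all_analysis.
From mathcomp Require Import complex ring.

Set Implicit Arguments.
Unset Strict Implicit.
Unset Printing Implicit Defensive.

Import Order.TTheory GRing.Theory Num.Theory.
Import numFieldNormedType.Exports.

Local Open Scope classical_set_scope.
Local Open Scope ring_scope.

Section Forms.
Variable R : realType.
Implicit Types u v x y z : 'rV[R]_8.

Definition dotp u v : R := \sum_(i < 8) u 0 i * v 0 i.

(* [j : 'I_4] stands for the index j + 1 of z_(j+1) = x_(2j+1) + i x_(2j+2). *)
Definition dz (j : 'I_4) v : R[i] :=
  Complex (v 0 (inord (2 * j))) (v 0 (inord (2 * j + 1))).

(* Wedge products follow the determinant convention,
   (a /\ b)(u, v) = a(u) b(v) - a(v) b(u). *)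
Definition omega u v : R :=
  complex.Re (Complex 0 2^-1 *
    \sum_(j < 4) (dz j u * conjc (dz j v) - dz j v * conjc (dz j u))).

Definition wedge22 (a b : 'rV[R]_8 -> 'rV[R]_8 -> R) (x y u v : 'rV[R]_8) : R :=
  a x y * b u v - a x u * b y v + a x v * b y u
  + a y u * b x v - a y v * b x u + a u v * b x y.

Definition Omega x y u v : R[i] :=
  \det (\matrix_(j < 4, k < 4) dz j [:: x; y; u; v]`_k).

Definition ReOmega x y u v : R := complex.Re (Omega x y u v).

Definition Phi x y u v : R :=
  2^-1 * wedge22 omega omega x y u v + ReOmega x y u v.

(* The vector representing [Phi x y z] with respect to [dotp]. *)
Definition cross x y z : 'rV[R]_8 := \row_i Phi x y z (delta_mx 0 i).

Lemma omegaE u v : omega u v = \sum_(j < 4)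
  (u 0 (inord (2 * j)) * v 0 (inord (2 * j + 1))
   - u 0 (inord (2 * j + 1)) * v 0 (inord (2 * j))).
Proof.
rewrite /omega mulr_sumr raddf_sum; apply: eq_bigr => j _ /=.
by field.
Qed.

Lemma Phi_linear x y z (a : R) u v :
  Phi x y z (a *: u + v) = a * Phi x y z u + Phi x y z v.
Proof.
have oL t : omega t (a *: u + v) = a * omega t u + omega t v.
  rewrite !omegaE mulr_sumr -big_split; apply: eq_bigr => j _ /=.
  by rewrite !mxE; ring.
have OL : ReOmega x y z (a *: u + v) = a * ReOmega x y z u + ReOmega x y z v.
  have cofE t t' i : cofactor (\matrix_(j < 4, k < 4) dz j [:: x; y; z; t]`_k) i (inord 3)
     = cofactor (\matrix_(j < 4, k < 4) dz j [:: x; y; z; t']`_k) i (inord 3).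
    rewrite /cofactor; congr (_ * \det _); apply/matrixP => p q; rewrite !mxE.
    congr (dz _ _); have : (lift (inord 3 : 'I_4) q < 3)%N.
      by rewrite /= /bump inordK //; case: q => [] [|[|[|]]].
    by move: (nat_of_ord _) => [|[|[|]]].
  rewrite /ReOmega /Omega !(expand_det_col _ (inord 3)) !raddf_sum mulr_sumr -big_split.
  apply: eq_bigr => i _ /=; rewrite (cofE _ 0 i) (cofE u 0 i) (cofE v 0 i).
  case: cofactor => c d; rewrite !mxE !inordK //= !mxE; ring.
by rewrite /Phi /wedge22 !oL OL; ring.
Qed.

Lemma crossP x y z v : dotp (cross x y z) v = Phi x y z v.
Proof.
have P0 : Phi x y z 0 = 0.
  have := Phi_linear x y z 1 0 0; rewrite scale1r addr0 mul1r => /eqP.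
  by rewrite -[X in X == _]addr0 (inj_eq (addrI _)) eq_sym => /eqP.
rewrite {2}(row_sum_delta v) /dotp.
rewrite (big_morph (Phi x y z) (id1 := 0) (op1 := +%R)) //; last first.
  by move=> s t; have := Phi_linear x y z 1 s t; rewrite scale1r mul1r.
apply: eq_bigr => i _; have := Phi_linear x y z (v 0 i) (delta_mx 0 i) 0.
by rewrite !addr0 P0 addr0 mxE mulrC => ->.
Qed.

End Forms.

Section Calculus.
Variable R : realType.

Definition ds : R * R := (1, 0).
Definition dt : R * R := (0, 1).

Fixpoint Ck (V : normedModType R) (k : nat) (U : set (R * R)) (f : R * R -> V)
    : Prop :=
  match k with
  | 0 => forall p, U p -> {for p, continuous f}
  | k'.+1 => [/\ forall p : R * R, U p -> differentiable f p,
                 Ck k' U (fun p => 'D_ds f p) &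
                 Ck k' U (fun p => 'D_dt f p)]
  end.

Definition smooth_on (V : normedModType R) (U : set (R * R)) (f : R * R -> V) :=
  forall k, Ck k U f.

Definition toC (p : R * R) : R[i] := Complex p.1 p.2.
Definition ofC (z : R[i]) : R * R := (complex.Re z, complex.Im z).

Definition holomorphic_at (f : R * R -> R * R) (p : R * R) : Prop :=
  derivable ((toC \o f \o ofC) : R[i]^o -> R[i]^o) (toC p) 1.

Definition jacobian_rows (E : normedModType R) (b : seq E) (F : E -> 'rV[R]_8)
    (q : E) : 'M[R]_(size b, 8) :=
  \matrix_(k < size b) 'D_(b`_k) F q.

End Calculus.
Arguments ds {R}.
Arguments dt {R}.

Record chart (R : realType) (T : topologicalType) := Chart {
  cdom : set T;
  coord : T -> R * R;
  cinv : R * R -> T;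
  cdom_open : open cdom;
  cimg_open : open (coord @` cdom);
  coordK : forall x, cdom x -> cinv (coord x) = x;
  coord_cont : forall x, cdom x -> {for x, continuous coord};
  cinv_cont : forall p, (coord @` cdom) p -> {for p, continuous cinv}
}.

Record riemannSurface (R : realType) := RiemannSurface {
  carrier :> topologicalType;
  rs_hausdorff : hausdorff_space carrier;
  rs_second_countable : @second_countable carrier;
  idx : Type;
  ch : idx -> chart R carrier;
  ch_cover : forall x : carrier, exists i, cdom (ch i) x;
  ch_holo : forall i j p,
    (coord (ch i) @` (cdom (ch i) `&` cdom (ch j))) p ->
    holomorphic_at (coord (ch j) \o cinv (ch i)) p
}.

Section Surface.
Variables (R : realType) (S : riemannSurface R).

Definition loc (V : Type) (i : idx S) (f : S -> V) : R * R -> V :=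
  f \o cinv (ch i).

Definition smooth (V : normedModType R) (f : S -> V) : Prop :=
  forall i, smooth_on (coord (ch i) @` cdom (ch i)) (loc i f).

(* A field of tangent vectors is given by its components in each chart:
   [w i x = (u, v)] means w = u d/ds + v d/dt at x in the chart i; the values
   outside the domain of the chart are irrelevant. *)
Definition tangent_field := idx S -> S -> R * R.

Definition vector_field (w : tangent_field) : Prop :=
  (forall i j x, cdom (ch i) x -> cdom (ch j) x ->
     w j x = 'D_(w i x) (coord (ch j) \o cinv (ch i)) (coord (ch i) x)) /\
  (forall i, smooth_on (coord (ch i) @` cdom (ch i)) (loc i (w i))).

Definition holomorphic_vector_field (w : tangent_field) : Prop :=
  vector_field w /\
  forall i p, (coord (ch i) @` cdom (ch i)) p -> holomorphic_at (loc i (w i)) p.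

Definition imul (w : tangent_field) : tangent_field :=
  fun i x => (- (w i x).2, (w i x).1).

Definition zero_field (w : tangent_field) : Prop :=
  forall i x, cdom (ch i) x -> w i x = 0.

Definition chart_at (x : S) : idx S := projT1 (cid (ch_cover x)).

(* Independent of the chart used, by the transformation rule for [w]. *)
Definition Lie (w : tangent_field) (V : normedModType R) (f : S -> V) (x : S)
    : V :=
  let i := chart_at x in 'D_(w i x) (loc i f) (coord (ch i) x).

Definition component (K : set S) : Prop :=
  exists x : S, K = connected_component [set: S] x.

Section TwoRuled.
Variables phi1 phi2 psi : S -> 'rV[R]_8.

Definition iotaM (q : (R * R) * S) : 'rV[R]_8 :=
  q.1.1 *: phi1 q.2 + q.1.2 *: phi2 q.2 + psi q.2.

Definition iotaM_loc (i : idx S) (q : (R * R) * (R * R)) : 'rV[R]_8 :=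
  iotaM (q.1, cinv (ch i) q.2).

Definition dir4 : seq ((R * R) * (R * R)) :=
  [:: ((1, 0), 0); ((0, 1), 0); (0, ds); (0, dt)].

Definition frame (i : idx S) (q : (R * R) * S) : 'M[R]_(4, 8) :=
  jacobian_rows dir4 (iotaM_loc i) (q.1, coord (ch i) q.2).

Definition regular : set ((R * R) * S) :=
  [set q | exists2 i, cdom (ch i) q.2 & row_free (frame i q)].

Definition r_framing : Prop :=
  [/\ smooth phi1, smooth phi2 &
   forall x, [/\ dotp (phi1 x) (phi1 x) = 1, dotp (phi2 x) (phi2 x) = 1 &
                 dotp (phi1 x) (phi2 x) = 0]].

(* Singular points are allowed, but the regular ones have to be dense. *)
Definition rframed_2ruled_4fold (M : set 'rV[R]_8) : Prop :=
  [/\ r_framing, smooth psi, M = range iotaM & dense regular].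

(* [eps q = 1] (resp. -1) when the orientation at q agrees (resp. disagrees)
   with that of the coordinates (r1, r2, s, t), which does not depend on the
   chart since changes of charts are holomorphic. *)
Definition orientation (eps : (R * R) * S -> R) : Prop :=
  (forall q, regular q -> eps q = 1 \/ eps q = -1) /\
  {within regular, continuous eps}.

Definition calibrated_by
    (a : 'rV[R]_8 -> 'rV[R]_8 -> 'rV[R]_8 -> 'rV[R]_8 -> R) : Prop :=
  exists eps, orientation eps /\
  forall i q, cdom (ch i) q.2 -> regular q ->
    let X := frame i q in
    let e k := row (inord k) X in
    a (e 0%N) (e 1%N) (e 2%N) (e 3%N) = eps q * Num.sqrt (\det (X *m X^T)).

Definition Cayley : Prop := calibrated_by (@Phi R).

Definition special_Lagrangian : Prop := calibrated_by (@ReOmega R).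

End TwoRuled.

Section Cone.
Variables phi1 phi2 : S -> 'rV[R]_8.

Definition link (q : S * R) : 'rV[R]_8 :=
  cos q.2 *: phi1 q.1 + sin q.2 *: phi2 q.1.

Definition dir3 : seq ((R * R) * R) := [:: (ds, 0); (dt, 0); (0, 1)].

Definition link_immersion : Prop :=
  forall i x theta, cdom (ch i) x ->
    row_free (jacobian_rows dir3 (fun q => link (cinv (ch i) q.1, q.2))
                (coord (ch i) x, theta)).

Definition rframed_2ruled_cone (M0 : set 'rV[R]_8) : Prop :=
  [/\ r_framing phi1 phi2, M0 = range (iotaM phi1 phi2 (fun=> 0)) &
      link_immersion].

Definition flat_gauge : Prop :=
  forall i x, cdom (ch i) x ->
  forall phi, phi = phi1 \/ phi = phi2 ->
    let dphi v := 'D_v (loc i phi) (coord (ch i) x) in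
    dphi dt = cross (phi1 x) (phi2 x) (dphi ds) /\
    dphi ds = - cross (phi1 x) (phi2 x) (dphi dt).

End Cone.

End Surface.

(* Main.v *)
(* Along a chart (s, t) write p, q for the framing, a, b for its s-derivatives
   and J = p x q x _; flatness says that the t-derivatives are Ja, Jb. The cone
   being special Lagrangian, p, q and all of a, b, Ja, Jb are Hermitian
   orthogonal, so in the unitary frame p, q, a, Ja every value of Phi becomes a
   2 x 2 computation. Differentiating the flat gauge equations and using the
   Cauchy-Riemann equations of w gives psi_t = J psi_s modulo p and q: the
   tangent vectors X_s, X_t of M are conformal modulo p and q, which is the
   Cayley condition.
   If M is special Lagrangian, then omega(p, psi_s) = omega(q, psi_s) = 0;
   differentiating omega(p, psi) = omega(q, psi) = 0 then gives
   omega(a, psi) = omega(b, psi) = 0, so where w does not vanish omega(a, b) =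
   omega(a, Jb) = 0. The symmetry of mixed derivatives gives g(Ja, b) = 0 as
   well, so b is a real multiple of a, against the immersion of the link. The
   same immersion excludes a constant cos(theta) p + sin(theta) q on a
   component, so both sides of the equivalence amount to w = 0. *)
Require Import Defs.
From mathcomp Require Import all_boot all_order all_algebra.
From mathcomp Require Import all_classical all_reals all_analysis.
From mathcomp Require Import complex ring lra zify.
Set Implicit Arguments.
Unset Strict Implicit.
Unset Printing Implicit Defensive.
Import Order.TTheory GRing.Theory Num.Theory.
Import numFieldNormedType.Exports.
Local Open Scope classical_set_scope.
Local Open Scope ring_scope.

(** * Hermitian linear algebra of C^4 *)

(** J is never treated as an operator: A = Ja is the family of equations g(A, v) = [Phi p q a v],
    and restricting the test vectors v to those orthogonal to p and q is what modulo p and q means.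
    The obstacle is that J varies with the point. In psi_t - J psi_s the second derivatives and the
    derivatives of w drop out, but the derivatives of J leave terms such as [Phi p b a v], where the
    first two slots are no longer p and q. They cancel only in two combinations, the coefficients of
    the components u and v of w. The cancellation can be computed because [Omega p q a A] is the
    positive number |a|^2, so that a Gram determinant against this frame gives a value of [Omega]
    with its phase. The Gram determinant of a frame of M is the square of m, the squared norm of X_s
    modulo p and q. This yields the volume with its sign, hence the orientation. Calibration is
    demanded at regular points only. As X_s depends affinely on r with independent coefficients, m
    vanishes at most once on a ruling plane; this gives both the density of the regular points and,
    over each point of the surface, a place where the condition can be used. *)

Lemma det_mx44 (K : comNzRingType) (M : 'M[K]_4) (m := fun j k => M (inord j) (inord k)) :
  \det M =
    m 0 0 * (m 1 1 * (m 2 2 * m 3 3 - m 2 3 * m 3 2)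
             - m 1 2 * (m 2 1 * m 3 3 - m 2 3 * m 3 1)
             + m 1 3 * (m 2 1 * m 3 2 - m 2 2 * m 3 1))
  - m 0 1 * (m 1 0 * (m 2 2 * m 3 3 - m 2 3 * m 3 2)
             - m 1 2 * (m 2 0 * m 3 3 - m 2 3 * m 3 0)
             + m 1 3 * (m 2 0 * m 3 2 - m 2 2 * m 3 0))
  + m 0 2 * (m 1 0 * (m 2 1 * m 3 3 - m 2 3 * m 3 1)
             - m 1 1 * (m 2 0 * m 3 3 - m 2 3 * m 3 0)
             + m 1 3 * (m 2 0 * m 3 1 - m 2 1 * m 3 0))
  - m 0 3 * (m 1 0 * (m 2 1 * m 3 2 - m 2 2 * m 3 1)
             - m 1 1 * (m 2 0 * m 3 2 - m 2 2 * m 3 0)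
             + m 1 2 * (m 2 0 * m 3 1 - m 2 1 * m 3 0)).
Proof.
have mE (i j : 'I_4) : M i j = m i j by rewrite /m !inord_val.
rewrite !(expand_det_row _ ord0) !big_ord_recl !big_ord0 /cofactor.
rewrite !(expand_det_row _ ord0) !big_ord_recl !big_ord0 /cofactor.
rewrite !(expand_det_row _ ord0) !big_ord_recl !big_ord0 /cofactor.
rewrite ?det_mx11 ?det_mx00 !mxE /=.
rewrite !mE /= /bump /=.
ring.
Qed.

Section Hermitian.
Variable R : realType.
Implicit Types p q a b x y z u v w : 'rV[R]_8.

Definition herm u v : R[i] := \sum_(j < 4) dz j u * conjc (dz j v).

Lemma dotpE u v : dotp u v = \sum_(j < 4)
  (u 0 (inord (2 * j)) * v 0 (inord (2 * j))
   + u 0 (inord (2 * j + 1)) * v 0 (inord (2 * j + 1))).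
Proof.
rewrite /dotp.
transitivity (\sum_(0 <= k < 8) u 0 (inord k) * v 0 (inord k)).
  by rewrite big_mkord; apply: eq_bigr => i _; rewrite inord_val.
rewrite -(big_mkord predT (fun j => u 0 (inord (2 * j)) * v 0 (inord (2 * j))
   + u 0 (inord (2 * j + 1)) * v 0 (inord (2 * j + 1)))).
by rewrite /index_iota /= !big_cons !big_nil !addrA.
Qed.

Lemma hermE u v : herm u v = Complex (dotp u v) (- omega u v).
Proof.
rewrite /herm dotpE omegaE; apply/eqP; rewrite eq_complex /=.
rewrite !raddf_sum /=; apply/andP.
by split; apply/eqP; apply: eq_bigr => j _ /=; ring.
Qed.

Lemma herm_conj u v : conjc (herm u v) = herm v u.
Proof.
rewrite /herm rmorph_sum; apply: eq_bigr => j _.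
by rewrite rmorphM [X in _ * X]conjcK mulrC.
Qed.

Lemma dotpC u v : dotp u v = dotp v u.
Proof. by apply: eq_bigr => i _; rewrite mulrC. Qed.

Lemma omegaC u v : omega u v = - omega v u.
Proof. by rewrite !omegaE -sumrN; apply: eq_bigr => i _; ring. Qed.

Lemma omega_id u : omega u u = 0.
Proof. by rewrite omegaE big1 // => i _; ring. Qed.

Lemma dz_linear j (c : R) u v : dz j (c *: u + v) = Complex c 0 * dz j u + dz j v.
Proof. by apply/eqP; rewrite eq_complex /= !mxE; apply/andP; split; apply/eqP; ring. Qed.

Lemma dotp_linear w (c : R) u v : dotp w (c *: u + v) = c * dotp w u + dotp w v.
Proof.
by rewrite /dotp mulr_sumr -big_split; apply: eq_bigr => i _ /=; rewrite !mxE; ring.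
Qed.

Lemma omega_linear w (c : R) u v : omega w (c *: u + v) = c * omega w u + omega w v.
Proof.
by rewrite !omegaE mulr_sumr -big_split; apply: eq_bigr => i _ /=; rewrite !mxE; ring.
Qed.

Lemma OmegaE x y u v : Omega x y u v =
  let m j k := dz (inord j) [:: x; y; u; v]`_k in
    m 0 0 * (m 1 1 * (m 2 2 * m 3 3 - m 2 3 * m 3 2)
             - m 1 2 * (m 2 1 * m 3 3 - m 2 3 * m 3 1)
             + m 1 3 * (m 2 1 * m 3 2 - m 2 2 * m 3 1))
  - m 0 1 * (m 1 0 * (m 2 2 * m 3 3 - m 2 3 * m 3 2)
             - m 1 2 * (m 2 0 * m 3 3 - m 2 3 * m 3 0)
             + m 1 3 * (m 2 0 * m 3 2 - m 2 2 * m 3 0))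
  + m 0 2 * (m 1 0 * (m 2 1 * m 3 3 - m 2 3 * m 3 1)
             - m 1 1 * (m 2 0 * m 3 3 - m 2 3 * m 3 0)
             + m 1 3 * (m 2 0 * m 3 1 - m 2 1 * m 3 0))
  - m 0 3 * (m 1 0 * (m 2 1 * m 3 2 - m 2 2 * m 3 1)
             - m 1 1 * (m 2 0 * m 3 2 - m 2 2 * m 3 0)
             + m 1 2 * (m 2 0 * m 3 1 - m 2 1 * m 3 0)).
Proof. by rewrite /Omega det_mx44 !mxE !inordK. Qed.

Lemma Omega_swap12 x y u v : Omega y x u v = - Omega x y u v.
Proof. by rewrite !OmegaE /=; ring. Qed.

Lemma Omega_swap23 x y u v : Omega x u y v = - Omega x y u v.
Proof. by rewrite !OmegaE /=; ring. Qed.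

Lemma Omega_swap34 x y u v : Omega x y v u = - Omega x y u v.
Proof. by rewrite !OmegaE /=; ring. Qed.

Lemma Omega_linear x y z (c : R) u v :
  Omega x y z (c *: u + v) = Complex c 0 * Omega x y z u + Omega x y z v.
Proof. by rewrite !OmegaE /= !dz_linear; ring. Qed.

(** The determinants are multiplied after transposing the first matrix and conjugating the second.
    Against a frame whose [Omega] is known, this recovers a value of [Omega], phase included, from
    Hermitian products. *)
Lemma Omega_herm x y u v x' y' u' v' :
  Omega x y u v * conjc (Omega x' y' u' v') =
  \det (\matrix_(k < 4, l < 4) herm [:: x; y; u; v]`_k [:: x'; y'; u'; v']`_l).
Proof.
rewrite /Omega -det_tr -det_map_mx -det_mulmx; congr (\det _).
apply/matrixP => k l; rewrite !mxE; apply: eq_bigr => j _.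
by rewrite !mxE.
Qed.

Lemma Phi_swap12 x y u v : Phi y x u v = - Phi x y u v.
Proof.
rewrite /Phi /wedge22 /ReOmega Omega_swap12 raddfN /=.
by rewrite (omegaC y x); ring.
Qed.

Lemma Phi_swap23 x y u v : Phi x u y v = - Phi x y u v.
Proof.
rewrite /Phi /wedge22 /ReOmega Omega_swap23 raddfN /=.
by rewrite (omegaC u y); ring.
Qed.

Lemma Phi_swap34 x y u v : Phi x y v u = - Phi x y u v.
Proof.
rewrite /Phi /wedge22 /ReOmega Omega_swap34 raddfN /=.
by rewrite (omegaC v u); ring.
Qed.

(** A predicate on plain functions, so that it applies to each slot of [dotp], [omega] and [Phi]
    with the other slots fixed. *)
Definition linear_form (f : 'rV[R]_8 -> R) :=
  forall c u v, f (c *: u + v) = c * f u + f v.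

Lemma linear_formP f : linear_form f ->
  [/\ forall u v, f (u + v) = f u + f v, forall c u, f (c *: u) = c * f u,
      forall u, f (- u) = - f u & f 0 = 0].
Proof.
move=> fL; have f0 : f 0 = 0.
  by have := fL (-1) 0 0; rewrite scaler0 addr0 => ->; ring.
have fZ c u : f (c *: u) = c * f u by rewrite -[c *: u]addr0 fL f0 addr0.
split=> // [u v|u]; first by rewrite -{1}[u]scale1r fL mul1r.
by rewrite -scaleN1r fZ mulN1r.
Qed.

Lemma linear_formE f : linear_form f -> forall u, f u = \sum_i u 0 i * f (delta_mx 0 i).
Proof.
move=> fL u; have [fD fZ _ f0] := linear_formP fL.
rewrite {1}(row_sum_delta u) (big_morph f (id1 := 0) (op1 := +%R)) //.
by apply: eq_bigr => i _; rewrite fZ.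
Qed.

Lemma dotp_lin w : [/\ forall u v, dotp w (u + v) = dotp w u + dotp w v,
  forall c u, dotp w (c *: u) = c * dotp w u,
  forall u, dotp w (- u) = - dotp w u & dotp w 0 = 0].
Proof. by apply: linear_formP => c u v; rewrite dotp_linear. Qed.

Lemma dotpDr w u v : dotp w (u + v) = dotp w u + dotp w v.
Proof. by case: (dotp_lin w). Qed.
Lemma dotpZr w c u : dotp w (c *: u) = c * dotp w u.
Proof. by case: (dotp_lin w). Qed.
Lemma dotpNr w u : dotp w (- u) = - dotp w u.
Proof. by case: (dotp_lin w). Qed.
Lemma dotp0r w : dotp w 0 = 0.
Proof. by case: (dotp_lin w). Qed.
Lemma dotpDl w u v : dotp (u + v) w = dotp u w + dotp v w.
Proof. by rewrite !(dotpC _ w) dotpDr. Qed.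
Lemma dotpZl w c u : dotp (c *: u) w = c * dotp u w.
Proof. by rewrite !(dotpC _ w) dotpZr. Qed.
Lemma dotpNl w u : dotp (- u) w = - dotp u w.
Proof. by rewrite !(dotpC _ w) dotpNr. Qed.
Lemma dotp0l w : dotp 0 w = 0.
Proof. by rewrite dotpC dotp0r. Qed.
Definition dotp_expand := (dotpDr, dotpDl, dotpZr, dotpZl, dotpNr, dotpNl, dotp0r, dotp0l).

Lemma omega_lin w : [/\ forall u v, omega w (u + v) = omega w u + omega w v,
  forall c u, omega w (c *: u) = c * omega w u,
  forall u, omega w (- u) = - omega w u & omega w 0 = 0].
Proof. by apply: linear_formP => c u v; rewrite omega_linear. Qed.

Lemma omegaDr w u v : omega w (u + v) = omega w u + omega w v.
Proof. by case: (omega_lin w). Qed.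
Lemma omegaZr w c u : omega w (c *: u) = c * omega w u.
Proof. by case: (omega_lin w). Qed.
Lemma omegaNr w u : omega w (- u) = - omega w u.
Proof. by case: (omega_lin w). Qed.
Lemma omega0r w : omega w 0 = 0.
Proof. by case: (omega_lin w). Qed.
Lemma omegaDl w u v : omega (u + v) w = omega u w + omega v w.
Proof. by rewrite !(omegaC _ w) omegaDr opprD. Qed.
Lemma omegaZl w c u : omega (c *: u) w = c * omega u w.
Proof. by rewrite !(omegaC _ w) omegaZr mulrN. Qed.
Lemma omegaNl w u : omega (- u) w = - omega u w.
Proof. by rewrite !(omegaC _ w) omegaNr. Qed.
Definition omega_expand := (omegaDr, omegaDl, omegaZr, omegaZl, omegaNr, omegaNl, omega0r).

Lemma Phi_lin x y z : [/\ forall u v, Phi x y z (u + v) = Phi x y z u + Phi x y z v,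
  forall c u, Phi x y z (c *: u) = c * Phi x y z u,
  forall u, Phi x y z (- u) = - Phi x y z u & Phi x y z 0 = 0].
Proof. by apply: linear_formP => c u v; rewrite Phi_linear. Qed.

Lemma PhiDr x y z u v : Phi x y z (u + v) = Phi x y z u + Phi x y z v.
Proof. by case: (Phi_lin x y z). Qed.
Lemma PhiZr x y z c u : Phi x y z (c *: u) = c * Phi x y z u.
Proof. by case: (Phi_lin x y z). Qed.
Lemma PhiNr x y z u : Phi x y z (- u) = - Phi x y z u.
Proof. by case: (Phi_lin x y z). Qed.
Lemma PhiDm x y z u v : Phi x y (u + v) z = Phi x y u z + Phi x y v z.
Proof. by rewrite !(Phi_swap34 _ _ z) PhiDr opprD. Qed.
Lemma PhiZm x y z c u : Phi x y (c *: u) z = c * Phi x y u z.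
Proof. by rewrite !(Phi_swap34 _ _ z) PhiZr mulrN. Qed.
Lemma PhiNm x y z u : Phi x y (- u) z = - Phi x y u z.
Proof. by rewrite !(Phi_swap34 _ _ z) PhiNr. Qed.

Lemma selfN_eq0 (c : R) : c = - c -> c = 0.
Proof. by move=> e; lra. Qed.

Lemma Phi_repeat x y z : (Phi x y z x = 0) * (Phi x y z y = 0) * (Phi x y z z = 0).
Proof.
have e34 u v w : Phi u v w w = 0 by apply: selfN_eq0; rewrite {1}Phi_swap34.
split; [split|]; last exact: e34.
  by rewrite Phi_swap12 Phi_swap23 e34 !oppr0.
by rewrite Phi_swap23 e34 oppr0.
Qed.

Lemma dotp_ge0 u : 0 <= dotp u u.
Proof. by apply: sumr_ge0 => i _; rewrite -expr2 sqr_ge0. Qed.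

Lemma dotp_eq0 u : dotp u u = 0 -> u = 0.
Proof.
move=> /eqP; rewrite /dotp psumr_eq0; last by move=> i _; rewrite -expr2 sqr_ge0.
move=> /allP u0; apply/rowP => i; rewrite mxE; apply/eqP.
by have := u0 i (mem_index_enum _); rewrite /= -expr2 sqrf_eq0.
Qed.

Lemma dotp_gt0 u : u != 0 -> 0 < dotp u u.
Proof.
move=> u0; rewrite lt_neqAle dotp_ge0 andbT eq_sym.
by apply: contra_neq u0 => /dotp_eq0.
Qed.

Lemma dotp_cauchy_schwarz u v : dotp u v ^+ 2 <= dotp u u * dotp v v.
Proof.
have [->|v0] := eqVneq v 0; first by rewrite !dotp0r expr0n mulr0.
have v1 := dotp_gt0 v0.
have := dotp_ge0 (dotp v v *: u - dotp u v *: v).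
have -> : dotp (dotp v v *: u - dotp u v *: v) (dotp v v *: u - dotp u v *: v)
   = dotp v v * (dotp u u * dotp v v - dotp u v ^+ 2).
  by rewrite !dotp_expand (dotpC v u); ring.
by rewrite pmulr_rge0 // subr_ge0.
Qed.

Lemma dotp_representation f : linear_form f -> exists N, forall v, dotp N v = f v.
Proof.
move=> fL; exists (\row_i f (delta_mx 0 i)) => v; rewrite (linear_formE fL).
by apply: eq_bigr => i _; rewrite mxE mulrC.
Qed.

(** Multiplication by i on C^4; with indices from 0, the pair (v_2j, v_(2j+1)) becomes (-v_(2j+1),
    v_2j). *)
Definition mulI v : 'rV[R]_8 :=
  \row_k (if odd k then v 0 (inord k.-1) else - v 0 (inord k.+1)).

Lemma dz_mulI j v : dz j (mulI v) = Complex 0 1 * dz j v.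
Proof.
have j1 : (2 * j < 8)%N by have := ltn_ord j; lia.
have j2 : (2 * j + 1 < 8)%N by have := ltn_ord j; lia.
rewrite /dz !mxE !inordK // oddM oddD oddM /= addn1 /=.
by apply/eqP; rewrite eq_complex /=; apply/andP; split; apply/eqP; ring.
Qed.

Lemma herm_mulI u v : herm u (mulI v) = Complex 0 (-1) * herm u v.
Proof.
rewrite /herm mulr_sumr; apply: eq_bigr => j _; rewrite dz_mulI.
by case: (dz j u) => ? ?; case: (dz j v) => ? ?;
  apply/eqP; rewrite eq_complex /=; apply/andP; split; apply/eqP; ring.
Qed.

Lemma Omega_mulI x y z v : Omega x y z (mulI v) = Complex 0 1 * Omega x y z v.
Proof. by rewrite !OmegaE /= !dz_mulI; ring. Qed.

(** The real parts agree by hypothesis; evaluating the hypothesis at i v gives the imaginary parts.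
    The conjugate appears because [herm] is antilinear in its second argument while [Omega] is
    linear. *)
Lemma herm_representation x y z N :
  (forall v, dotp N v = ReOmega x y z v) ->
  forall v, herm N v = conjc (Omega x y z v).
Proof.
move=> N_ v; have := N_ v; have := N_ (mulI v).
have reh u w : dotp u w = complex.Re (herm u w) by rewrite hermE.
rewrite !reh /ReOmega herm_mulI Omega_mulI.
case: (herm N v) => r s; case: (Omega x y z v) => r' s' /= e1 e2.
by apply/eqP; rewrite eq_complex /= e2 eqxx /=; apply/eqP; move: e1; lra.
Qed.

(** Each term of the square of omega pairs two of p, q, a with each other. *)
Lemma Phi_isotropic p q a v : omega p q = 0 -> omega p a = 0 -> omega q a = 0 ->
  Phi p q a v = ReOmega p q a v.
Proof. by rewrite /Phi /wedge22 => -> -> ->; ring. Qed.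

Lemma herm_cross p q a A : omega p q = 0 -> omega p a = 0 -> omega q a = 0 ->
  (forall v, dotp A v = Phi p q a v) ->
  forall v, herm A v = conjc (Omega p q a v).
Proof.
move=> pq pa qa A_; apply: herm_representation => v.
by rewrite A_ Phi_isotropic.
Qed.

Lemma Omega_hermE x y u v x' y' u' v' :
  Omega x y u v * conjc (Omega x' y' u' v') =
  let m j k := herm [:: x; y; u; v]`_j [:: x'; y'; u'; v']`_k in
    m 0 0 * (m 1 1 * (m 2 2 * m 3 3 - m 2 3 * m 3 2)
             - m 1 2 * (m 2 1 * m 3 3 - m 2 3 * m 3 1)
             + m 1 3 * (m 2 1 * m 3 2 - m 2 2 * m 3 1))
  - m 0 1 * (m 1 0 * (m 2 2 * m 3 3 - m 2 3 * m 3 2)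
             - m 1 2 * (m 2 0 * m 3 3 - m 2 3 * m 3 0)
             + m 1 3 * (m 2 0 * m 3 2 - m 2 2 * m 3 0))
  + m 0 2 * (m 1 0 * (m 2 1 * m 3 3 - m 2 3 * m 3 1)
             - m 1 1 * (m 2 0 * m 3 3 - m 2 3 * m 3 0)
             + m 1 3 * (m 2 0 * m 3 1 - m 2 1 * m 3 0))
  - m 0 3 * (m 1 0 * (m 2 1 * m 3 2 - m 2 2 * m 3 1)
             - m 1 1 * (m 2 0 * m 3 2 - m 2 2 * m 3 0)
             + m 1 2 * (m 2 0 * m 3 1 - m 2 1 * m 3 0)).
Proof. by rewrite Omega_herm det_mx44 !mxE !inordK. Qed.

Lemma Omega_repeat x y z : (Omega x y z x = 0) * (Omega x y z y = 0) * (Omega x y z z = 0).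
Proof. by rewrite !OmegaE /=; split; [split|]; ring. Qed.

(* The vector [N] representing Re Omega(p, q, x, _) has [|N|^2] equal to the
   Hermitian Gram determinant of p, q, x, that is |x|^2 minus squares of values
   of omega; equality in Cauchy-Schwarz for [N] and [y] kills these values. *)
Lemma calibrated_isotropic p q x y :
  dotp p p = 1 -> dotp q q = 1 -> dotp p q = 0 ->
  dotp p x = 0 -> dotp q x = 0 -> 0 < dotp x x -> 0 < dotp y y ->
  ReOmega p q x y ^+ 2 = dotp x x * dotp y y ->
  [/\ omega p q = 0, omega p x = 0 & omega q x = 0].
Proof.
move=> pp qq pq px qx x0 y0 e.
have RL : linear_form (ReOmega p q x).
  move=> c u v; rewrite /ReOmega Omega_linear; case: (Omega p q x u) => ? ?.
  by case: (Omega p q x v) => ? ? /=; ring.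
have [N N_] := dotp_representation RL.
have hN := herm_representation N_.
have hN0 : (herm N p = 0) * (herm N q = 0) * (herm N x = 0).
  by rewrite !hN !Omega_repeat !conjc0.
have hN0' : (herm p N = 0) * (herm q N = 0) * (herm x N = 0).
  by rewrite -!(herm_conj N) !hN0 !conjc0.
have tE : dotp N N * dotp N N = dotp N N * (dotp x x - dotp x x * omega p q ^+ 2
    - omega p x ^+ 2 - omega q x ^+ 2).
  have := Omega_hermE p q x N p q x N.
  have -> : Omega p q x N = herm N N by rewrite -[LHS]conjcK -hN herm_conj.
  rewrite herm_conj /= !hN0 !hN0' !hermE !omega_id pp qq pq px qx.
  rewrite (dotpC q p) (dotpC x p) (dotpC x q) pq px qx.
  rewrite (omegaC q p) (omegaC x p) (omegaC x q).
  move=> /(congr1 (@complex.Re R)) /= h.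
  rewrite oppr0 mulr0 subr0 in h; rewrite h; ring.
have cs := dotp_cauchy_schwarz N y; rewrite N_ e ler_pM2r // in cs.
have t0 : 0 < dotp N N by apply: lt_le_trans cs.
have {}tE := mulfI (lt0r_neq0 t0) tE.
have h1 := sqr_ge0 (omega p x); have h2 := sqr_ge0 (omega q x).
have h3 : 0 <= dotp x x * omega p q ^+ 2 by rewrite mulr_ge0 ?sqr_ge0 ?ltW.
have e1 : omega p x ^+ 2 = 0 by lra.
have e2 : omega q x ^+ 2 = 0 by lra.
have e3 : dotp x x * omega p q ^+ 2 = 0 by lra.
move: e1 e2 e3 => /eqP; rewrite sqrf_eq0 => /eqP -> /eqP; rewrite sqrf_eq0 => /eqP ->.
by move=> /eqP; rewrite mulf_eq0 (gt_eqF x0) sqrf_eq0 => /eqP ->.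
Qed.

End Hermitian.

(** * Isotropic frames *)

Section IsotropicFrame.
Variable R : realType.
Implicit Types p q a b A B x y z u v w : 'rV[R]_8.

(* [A] and [B] are the images of [a] and [b] under J = p x q x _. *)
Record isotropic_frame p q a b A B : Prop := IsotropicFrame {
  iso_pp : dotp p p = 1;
  iso_qq : dotp q q = 1;
  iso_pq : dotp p q = 0;
  iso_A : forall v, dotp A v = Phi p q a v;
  iso_a : forall v, dotp a v = - Phi p q A v;
  iso_B : forall v, dotp B v = Phi p q b v;
  iso_b : forall v, dotp b v = - Phi p q B v;
  iso_wpq : omega p q = 0;
  iso_wpa : omega p a = 0;
  iso_wqa : omega q a = 0;
  iso_wpb : omega p b = 0;
  iso_wqb : omega q b = 0
}.

Section Tables.
Variables p q a b A B : 'rV[R]_8.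
Hypothesis fr : isotropic_frame p q a b A B.

Lemma iso_hA v : herm A v = conjc (Omega p q a v).
Proof. by case: fr => *; apply: herm_cross. Qed.

Lemma iso_hB v : herm B v = conjc (Omega p q b v).
Proof. by case: fr => *; apply: herm_cross. Qed.

(** [Omega p q a] vanishes on p, q and a, so A is Hermitian orthogonal to all three. *)
Lemma iso_wA : (omega p A = 0) * (omega q A = 0) * (omega a A = 0).
Proof.
have h v : Omega p q a v = 0 -> omega v A = 0.
  move=> o; have := iso_hA v; rewrite o conjc0 hermE => -[_ /eqP].
  by rewrite oppr_eq0 omegaC oppr_eq0 => /eqP.
by rewrite !h // Omega_repeat.
Qed.

Lemma iso_wB : (omega p B = 0) * (omega q B = 0) * (omega b B = 0).
Proof.
have h v : Omega p q b v = 0 -> omega v B = 0.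
  move=> o; have := iso_hB v; rewrite o conjc0 hermE => -[_ /eqP].
  by rewrite oppr_eq0 omegaC oppr_eq0 => /eqP.
by rewrite !h // Omega_repeat.
Qed.

(** The quarter turn a -> A -> -a of J: what holds for the coordinates (s, t) also holds for (t,
    -s). *)
Lemma iso_rot : isotropic_frame p q A B (- a) (- b).
Proof.
case: (fr) => ? ? ? hA ha hB hb *; split=> //; rewrite ?iso_wA ?iso_wB //.
all: by move=> v; rewrite ?dotpNl ?PhiNm ?opprK ?ha ?hb ?opprK.
Qed.

Lemma iso_ha v : herm a v = - conjc (Omega p q A v).
Proof.
have := @herm_cross _ p q A (- a); rewrite !iso_wA => h.
have na w : dotp (- a) w = Phi p q A w by rewrite dotpNl (iso_a fr) opprK.
rewrite -(h (iso_wpq fr) _ _ na) // !hermE dotpNl omegaNl.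
by apply/eqP; rewrite eq_complex /= !opprK !eqxx.
Qed.

Lemma iso_dotA : dotp A A = dotp a a.
Proof. by rewrite (iso_A fr) (iso_a fr) Phi_swap34. Qed.

Lemma iso_dot0 : (dotp p a = 0) * (dotp q a = 0) * (dotp p A = 0) * (dotp q A = 0)
  * (dotp a A = 0).
Proof.
rewrite (dotpC p a) (dotpC q a) (dotpC p A) (dotpC q A).
by rewrite !(iso_A fr) !(iso_a fr) !Phi_repeat oppr0.
Qed.

Lemma iso_dot0b : (dotp p b = 0) * (dotp q b = 0) * (dotp p B = 0) * (dotp q B = 0)
  * (dotp b B = 0).
Proof.
rewrite (dotpC p b) (dotpC q b) (dotpC p B) (dotpC q B).
by rewrite !(iso_B fr) !(iso_b fr) !Phi_repeat oppr0.
Qed.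

(** [herm A b] and [herm B a] are the conjugates of [Omega p q a b] and [Omega p q b a], which
    differ by a sign; the equality is that of their imaginary parts. *)
Lemma iso_wAb : omega A b = omega a B.
Proof.
have := iso_hA b; have := iso_hB a; rewrite Omega_swap34 raddfN /= => eB eA.
by move: eB; rewrite -eA !hermE => -[_] /= /eqP; rewrite opprK (omegaC B a) opprK => /eqP.
Qed.

Hypothesis a0 : a != 0.
Let n := Complex (dotp a a) 0.
Let n0 : n != 0.
Proof. by rewrite eq_complex /= eqxx andbT gt_eqF // dotp_gt0. Qed.

(** The phase is fixed here: p, q, a, A is an orthogonal basis of C^4 on which [Omega] is real and
    positive. *)
Lemma iso_Omega : Omega p q a A = n.
Proof.
rewrite -[LHS]conjcK -iso_hA herm_conj hermE iso_dotA omega_id.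
by rewrite /n oppr0.
Qed.

(** Up to the factor n, the components of b along A and along a are [D] and [k]: b = (k a + D A) /
    n. *)
Let D := Omega p q a b.
Let k := herm b a.

Lemma iso_hp : (herm p p = 1) * (herm p q = 0) * (herm p a = 0) * (herm p A = 0).
Proof.
by rewrite !hermE (iso_pp fr) (iso_pq fr) !iso_dot0 !iso_wA (iso_wpq fr) (iso_wpa fr)
  omega_id !oppr0.
Qed.

Lemma iso_hq : (herm q p = 0) * (herm q q = 1) * (herm q a = 0) * (herm q A = 0).
Proof.
rewrite !hermE (iso_qq fr) (dotpC q p) (iso_pq fr) !iso_dot0 !iso_wA (omegaC q p).
by rewrite (iso_wpq fr) (iso_wqa fr) omega_id !oppr0.
Qed.

Lemma iso_ha_row : (herm a p = 0) * (herm a q = 0) * (herm a a = n) * (herm a A = 0).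
Proof.
rewrite -(herm_conj p) -(herm_conj q) iso_hp iso_hq !hermE iso_dot0 iso_wA omega_id.
by rewrite !oppr0 !conjc0.
Qed.

Lemma iso_hA_row : (herm A p = 0) * (herm A q = 0) * (herm A a = 0) * (herm A A = n).
Proof.
rewrite -(herm_conj p) -(herm_conj q) -(herm_conj a) iso_hp iso_hq iso_ha_row.
by rewrite !hermE iso_dotA omega_id !oppr0 !conjc0.
Qed.

Lemma iso_hb_row : (herm b p = 0) * (herm b q = 0) * (herm b A = D).
Proof.
rewrite -(herm_conj A b) iso_hA conjcK /D !hermE.
rewrite (dotpC b p) (dotpC b q) !iso_dot0b (omegaC b p) (omegaC b q).
by rewrite (iso_wpb fr) (iso_wqb fr) !oppr0.
Qed.

(** In other words B = (conj k A - conj D a) / n: on the complex span of a and A the map J is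
    conjugate-linear. *)
Lemma iso_hB_row : (herm B p = 0) * (herm B q = 0) * (herm B a = - conjc D)
  * (herm B A = conjc k).
Proof.
rewrite !iso_hB !Omega_repeat conjc0 /k herm_conj iso_ha /D.
by rewrite (Omega_swap34 p q a b) (Omega_swap34 p q A b) !raddfN.
Qed.

Lemma iso_Omega_mul x y z v : Omega x y z v * n =
  Omega x y z v * conjc (Omega p q a A).
Proof. by rewrite iso_Omega /n /= oppr0. Qed.

Variable v : 'rV[R]_8.
Hypotheses (pv : dotp p v = 0) (qv : dotp q v = 0).

(* Each value is read off its product with Omega p q a A, a determinant of
   Hermitian products against the orthogonal frame p, q, a, A. *)
Lemma iso_OmegaE :
  [/\ Omega p b a v = - D * herm v q, Omega A q b v = - k * herm v p,
      Omega p B b v * n = - (D * conjc D + k * conjc k) * herm v q,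
      Omega A q a v = - n * herm v p &
      Omega p B a v = - conjc k * herm v q /\ Omega a q b v = D * herm v p].
Proof.
have tables := (iso_hp, iso_hq, iso_ha_row, iso_hA_row, iso_hb_row, iso_hB_row).
split; [| | | | split].
3: by rewrite iso_Omega_mul Omega_hermE /= !tables -/k; ring.
all: by apply: (mulIf n0); rewrite iso_Omega_mul Omega_hermE /= !tables -/k; ring.
Qed.

Let hvp : herm v p = Complex 0 (omega p v).
Proof. by rewrite hermE dotpC pv (omegaC v p) opprK. Qed.
Let hvq : herm v q = Complex 0 (omega q v).
Proof. by rewrite hermE dotpC qv (omegaC v q) opprK. Qed.
Let kE : k = Complex (dotp b a) (- omega b a). Proof. exact: hermE. Qed.
Let DE : D = Complex (dotp A b) (omega A b).
Proof. by rewrite /D -[LHS]conjcK -iso_hA hermE /= opprK. Qed.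

(** The coefficient of u in psi_t - J psi_s. Since v is orthogonal to p and q, [herm v p] and
    [herm v q] are imaginary, so the real parts of [Omega] become products of two values of omega.
    The [Omega] part of the first term cancels the omega part of the second and conversely; the
    third term vanishes by itself. *)
Lemma triple_product_u : Phi p b a v + Phi A q b v + Phi p B b v = 0.
Proof.
have [e1 e2 e3 _ _] := iso_OmegaE.
have r3 : complex.Re (Omega p B b v) = 0.
  apply: (mulIf (lt0r_neq0 (dotp_gt0 a0))).
  move: e3 => /(congr1 (@complex.Re R)); rewrite hvq kE DE /n.
  by case: (Omega p B b v) => r s /= h; rewrite mul0r -[LHS]subr0 -(mulr0 s) h; ring.
rewrite /Phi /wedge22 /ReOmega e1 e2 r3 hvp hvq kE DE /=.
rewrite (omegaC A q) (omegaC B b) !iso_wA !iso_wB (iso_wpa fr) (iso_wpb fr) (iso_wqb fr).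
by field.
Qed.

(** The coefficient of v in psi_t - J psi_s. Here the last two terms cancel each other, by
    [iso_wAb]. *)
Lemma triple_product_v : Phi A q a v + Phi p B a v - Phi a q b v = 0.
Proof.
have [_ _ _ e1 [e2 e3]] := iso_OmegaE.
rewrite /Phi /wedge22 /ReOmega e1 e2 e3 hvp hvq kE DE /n /=.
rewrite (omegaC A q) (omegaC A a) (omegaC a q) (omegaC B a) (omegaC b a).
rewrite !iso_wA !iso_wB iso_wAb (iso_wpa fr) (iso_wqa fr) (iso_wqb fr).
by field.
Qed.

End Tables.

(** The left-hand side is b made orthogonal to a and scaled. It is Hermitian orthogonal to p, q, a
    and A, which form a basis because their [Omega] is nonzero. *)
Lemma isotropic_frame_dependent p q a b A B : isotropic_frame p q a b A B ->
  a != 0 -> dotp A b = 0 -> omega a b = 0 -> omega A b = 0 ->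
  dotp a a *: b - dotp a b *: a = 0.
Proof.
move=> fr a0 Ab wab wAb; set c := _ - _.
have hc : (herm c p = 0) * (herm c q = 0) * (herm c a = 0) * (herm c A = 0).
  rewrite !hermE /c !dotp_expand !omega_expand.
  rewrite !(dotpC _ p) !(dotpC _ q) (dotpC b a) (dotpC b A) !(iso_dot0 fr) !(iso_dot0b fr).
  rewrite !(omegaC _ p) !(omegaC _ q) (omegaC b a) (omegaC b A) !(iso_wA fr) omega_id.
  rewrite (iso_wpb fr) (iso_wqb fr) (iso_wpa fr) (iso_wqa fr) wab wAb Ab.
  rewrite !(oppr0, mulr0, subr0).
  by rewrite (mulrC (dotp a a)) subrr addr0 !oppr0.
pose M := \matrix_(j < 4, l < 4) dz j [:: p; q; a; A]`_l.
have uM : M \in unitmx.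
  rewrite unitmxE -[\det M]/(Omega p q a A) (iso_Omega fr) unitfE.
  by rewrite eq_complex /= eqxx andbT gt_eqF // dotp_gt0.
pose r := \row_j conjc (dz j c).
have rM : r *m M = 0.
  have h (l : 'I_4) : herm c [:: p; q; a; A]`_l = 0.
    by case: l => [[|[|[|[|]]]]] //= _; rewrite hc.
  apply/rowP => l; have := h l; rewrite -herm_conj => /eqP; rewrite conjc_eq0 => /eqP.
  rewrite /herm => hl; rewrite !mxE -[RHS]hl; apply: eq_bigr => j _.
  by rewrite !mxE mulrC.
have r0 : r = 0 by rewrite -[r](mulmxK uM) rM mul0mx.
have d0 j : dz j c = 0.
  by have /rowP/(_ j) := r0; rewrite !mxE => /eqP; rewrite conjc_eq0 => /eqP.
apply: dotp_eq0; have : herm c c = 0 by rewrite /herm big1 // => j _; rewrite d0 mul0r.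
by rewrite hermE => -[].
Qed.

Lemma isotropic_combination p q a b A B (u v : R) : isotropic_frame p q a b A B ->
  omega p (u *: a + v *: A - v *: b + u *: B) = 0 /\
  omega q (u *: a + v *: A - v *: b + u *: B) = 0.
Proof.
move=> fr; rewrite !(omegaDr, omegaNr, omegaZr) (iso_wpa fr) (iso_wqa fr) (iso_wpb fr).
by rewrite (iso_wqb fr) !(iso_wA fr) !(iso_wB fr) !mulr0 !subr0 !addr0.
Qed.

(** With X = omega(a, b) and Y = omega(a, B) = omega(A, b), the last two hypotheses read u Y - v X =
    0 and u X + v Y = 0. Unless u = v = 0 this system is invertible, so X = Y = 0 and b is
    proportional to a. *)
Lemma isotropic_coefficients_eq0 p q a b A B (u v : R) :
  isotropic_frame p q a b A B -> a != 0 -> dotp A b = 0 ->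
  (forall al be : R, al *: a + be *: b = 0 -> (al, be) = 0) ->
  omega a (u *: a + v *: A - v *: b + u *: B) = 0 ->
  omega b (u *: a + v *: A - v *: b + u *: B) = 0 -> (u, v) = 0.
Proof.
move=> fr a0 Ab ind wa wb.
rewrite !(omegaDr, omegaNr, omegaZr) omega_id !(iso_wA fr) in wa.
rewrite !(omegaDr, omegaNr, omegaZr) omega_id !(iso_wB fr) in wb.
rewrite (omegaC b a) (omegaC b A) (iso_wAb fr) in wb.
apply/eqP; apply: contraT => uv0.
have s0 : u ^+ 2 + v ^+ 2 != 0.
  apply: contra_neq uv0 => /eqP; rewrite paddr_eq0 ?sqr_ge0 // !sqrf_eq0.
  by move=> /andP[/eqP -> /eqP ->].
have w1 : omega a b = 0.
  apply: (mulfI s0); rewrite mulr0; move: wa wb.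
  move: (omega a b) (omega a B) => X Y wa wb.
  have -> : (u ^+ 2 + v ^+ 2) * X = - v * (u * 0 + v * 0 - v * X + u * Y)
    - u * (u * (- X) + v * (- Y) - v * 0 + u * 0) by ring.
  by rewrite wa wb; ring.
have w2 : omega A b = 0.
  rewrite (iso_wAb fr); apply: (mulfI s0); rewrite mulr0; move: wa wb.
  move: (omega a b) (omega a B) => X Y wa wb.
  have -> : (u ^+ 2 + v ^+ 2) * Y = u * (u * 0 + v * 0 - v * X + u * Y)
    - v * (u * (- X) + v * (- Y) - v * 0 + u * 0) by ring.
  by rewrite wa wb; ring.
have := isotropic_frame_dependent fr a0 Ab w1 w2; rewrite addrC -scaleNr => /ind [_ /eqP].
by rewrite (gt_eqF (dotp_gt0 a0)).
Qed.

End IsotropicFrame.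

(** * Conformal frames *)

Section Gram.
Variable R : realType.
Implicit Types p q x y z v : 'rV[R]_8.

Definition reject p q x : 'rV[R]_8 := x - dotp p x *: p - dotp q x *: q.

Lemma gram_entry m (X : 'M[R]_(m, 8)) i j :
  (X *m X^T) i j = dotp (row i X) (row j X).
Proof. by rewrite mxE; apply: eq_bigr => k _; rewrite !mxE. Qed.

Lemma row_free_gram m (X : 'M[R]_(m, 8)) : \det (X *m X^T) != 0 -> row_free X.
Proof.
rewrite -unitfE -unitmxE => u; have := mxrankM_maxl X X^T.
by rewrite (mxrank_unit u) /row_free eqn_leq rank_leq_row => ->.
Qed.

Section Conformal.
Variables p q x y : 'rV[R]_8.
Hypotheses (pp : dotp p p = 1) (qq : dotp q q = 1) (pq : dotp p q = 0).

Lemma dotp_reject z w : dotp (reject p q z) w =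
  dotp z w - dotp p z * dotp p w - dotp q z * dotp q w.
Proof. by rewrite /reject !dotp_expand; ring. Qed.

Lemma reject_orthogonal z : dotp p (reject p q z) = 0 /\ dotp q (reject p q z) = 0.
Proof.
by rewrite !(dotpC _ (reject _ _ _)) !dotp_reject (dotpC q p) pp qq pq !(dotpC z);
  split; ring.
Qed.

Lemma reject_idem z w : dotp (reject p q z) (reject p q w) = dotp (reject p q z) w.
Proof.
have [e1 e2] := reject_orthogonal z.
rewrite [X in dotp _ X = _]/reject !(dotpDr, dotpNr, dotpZr).
by rewrite !(dotpC (reject _ _ _) p) !(dotpC (reject _ _ _) q) e1 e2; ring.
Qed.

Lemma Phi_reject z w : Phi p q z (reject p q w) = Phi p q z w.
Proof. by rewrite /reject !(PhiDr, PhiNr, PhiZr) !Phi_repeat; ring. Qed.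

Lemma ReOmega_reject z w : ReOmega p q (reject p q z) (reject p q w) = ReOmega p q z w.
Proof.
rewrite /ReOmega /reject; congr complex.Re.
have lin u (c d : R) : Omega p q u (w - c *: p - d *: q) = Omega p q u w.
  by rewrite -!scaleNr addrC Omega_linear [w + _]addrC Omega_linear !Omega_repeat; ring.
rewrite lin Omega_swap34 [RHS]Omega_swap34; congr (- _).
rewrite -!scaleNr addrC Omega_linear [z + _]addrC Omega_linear !Omega_repeat; ring.
Qed.

(** These say y = Jx and x = -Jy modulo p and q. *)
Hypotheses (xy : forall v, dotp p v = 0 -> dotp q v = 0 -> dotp y v = Phi p q x v)
  (yx : forall v, dotp p v = 0 -> dotp q v = 0 -> dotp x v = - Phi p q y v).
Let m := dotp (reject p q x) (reject p q x).

Lemma conformal_frame : [/\ Phi p q x y = m, dotp (reject p q y) (reject p q y) = m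
  & dotp (reject p q x) (reject p q y) = 0].
Proof.
have [px qx] := reject_orthogonal x; have [py qy] := reject_orthogonal y.
have eyy : dotp (reject p q y) (reject p q y) = Phi p q x y.
  by rewrite reject_idem dotpC xy // Phi_reject.
have exx : m = Phi p q x y.
  by rewrite /m reject_idem dotpC yx // Phi_reject Phi_swap34 opprK.
by split; rewrite ?eyy ?exx // reject_idem dotpC xy // Phi_reject !Phi_repeat.
Qed.

(** Subtracting multiples of p and q from the last two rows leaves the Gram determinant unchanged
    and makes the Gram matrix diagonal, with entries 1, 1, m, m. *)
Lemma det_gram_conformal (X : 'M[R]_(4, 8)) :
  row (inord 0) X = p -> row (inord 1) X = q -> row (inord 2) X = x ->
  row (inord 3) X = y -> \det (X *m X^T) = m ^+ 2.
Proof.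
move=> r0 r1 r2 r3; have [_] := conformal_frame.
rewrite /m !reject_idem !dotp_reject => e1 e2.
rewrite det_mx44 !gram_entry r0 r1 r2 r3 pp qq pq (dotpC q p) pq.
rewrite !(dotpC x p) !(dotpC x q) !(dotpC y p) !(dotpC y q) (dotpC y x).
have exy : dotp x y = dotp p x * dotp p y + dotp q x * dotp q y by lra.
have eyy : dotp y y = dotp x x - dotp p x * dotp p x - dotp q x * dotp q x
   + dotp p y * dotp p y + dotp q y * dotp q y by lra.
by rewrite exy eyy; ring.
Qed.

Lemma conformal_isotropic : m != 0 -> ReOmega p q x y ^+ 2 = m ^+ 2 ->
  [/\ omega p q = 0, omega p (reject p q x) = 0 & omega q (reject p q x) = 0].
Proof.
move=> m0 e; have [_ my _] := conformal_frame.
have [px qx] := reject_orthogonal x.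
have mpos : 0 < m by rewrite lt_neqAle eq_sym m0 dotp_ge0.
apply: (calibrated_isotropic pp qq pq px qx mpos (y := reject p q y)).
  by rewrite my.
by rewrite my ReOmega_reject e expr2.
Qed.

End Conformal.

Lemma omega_reject p q u x : omega u p = 0 -> omega u q = 0 ->
  omega u (reject p q x) = omega u x.
Proof.
by move=> up uq; rewrite /reject !(omegaDr, omegaNr, omegaZr) up uq !mulr0 !subr0.
Qed.

End Gram.

(** * The derivatives of psi modulo p and q *)

Section RuledDerivative.
Variable R : realType.
Implicit Types p q a b A B x y z : 'rV[R]_8.

Lemma PhiN1 x y z w : Phi (- x) y z w = - Phi x y z w :> R.
Proof. by rewrite Phi_swap12 Phi_swap23 PhiNm Phi_swap23 Phi_swap12 !opprK. Qed.

Lemma PhiN2 x y z w : Phi x (- y) z w = - Phi x y z w :> R.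
Proof. by rewrite Phi_swap23 PhiNm Phi_swap23 !opprK. Qed.

(** The hypotheses on [Pst], [Ptt], [Qst], [Qtt] are the flat gauge equations differentiated in s
    and t. The Cauchy-Riemann equations match the first-order terms of both sides, the values of
    [Phi p q] on second derivatives cancel, and u times [triple_product_u] plus v times
    [triple_product_v] remains. *)
Lemma ruled_derivative_st p q a b A B Pss Pst Ptt Qss Qst Qtt (u v us ut vs vt : R) :
  isotropic_frame p q a b A B -> a != 0 -> us = vt -> ut = - vs ->
  (forall w, dotp Pst w = Phi a q a w + Phi p b a w + Phi p q Pss w) ->
  (forall w, dotp Ptt w = Phi A q a w + Phi p B a w + Phi p q Pst w) ->
  (forall w, dotp Qst w = Phi a q b w + Phi p b b w + Phi p q Qss w) ->
  (forall w, dotp Qtt w = Phi A q b w + Phi p B b w + Phi p q Qst w) ->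
  forall w, dotp p w = 0 -> dotp q w = 0 ->
  dotp (ut *: a + u *: Pst + (vt *: A + v *: Ptt) - (vt *: b + v *: Qst)
        + (ut *: B + u *: Qtt)) w
  = Phi p q (us *: a + u *: Pss + (vs *: A + v *: Pst) - (vs *: b + v *: Qss)
        + (us *: B + u *: Qst)) w.
Proof.
move=> fr a0 -> -> hPst hPtt hQst hQtt w pw qw.
have u0 := triple_product_u fr a0 pw qw; have v0 := triple_product_v fr a0 pw qw.
have z23 x y : Phi x y y w = 0 by apply: selfN_eq0; rewrite {1}Phi_swap23.
have z13 x y : Phi x y x w = 0 by rewrite Phi_swap12 z23 oppr0.
rewrite !(dotpDl, dotpNl, dotpZl) !(PhiDm, PhiNm, PhiZm) hPst hPtt hQst hQtt.
rewrite !(iso_A fr) !(iso_B fr) (iso_a fr) (iso_b fr) !z23 !z13.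
have -> : Phi p b a w = - (Phi A q b w + Phi p B b w).
  by apply/eqP; rewrite -addr_eq0 addrA u0.
have -> : Phi A q a w = Phi a q b w - Phi p B a w.
  by apply/eqP; rewrite eq_sym subr_eq eq_sym -subr_eq0 v0.
move: (Phi A q b w) (Phi p B b w) (Phi a q b w) (Phi p B a w) (Phi p q _ w) (Phi p q _ w)
  (Phi p q _ w) (Phi p q _ w) (Phi p q _ w) (Phi p q _ w) (Phi p q _ w) (Phi p q _ w) => *.
ring.
Qed.

Lemma ruled_derivative_ts p q a b A B Pss Pst Ptt Qss Qst Qtt (u v us ut vs vt : R) :
  isotropic_frame p q a b A B -> a != 0 -> us = vt -> ut = - vs ->
  (forall w, dotp Pss w = - (Phi a q A w + Phi p b A w + Phi p q Pst w)) ->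
  (forall w, dotp Pst w = - (Phi A q A w + Phi p B A w + Phi p q Ptt w)) ->
  (forall w, dotp Qss w = - (Phi a q B w + Phi p b B w + Phi p q Qst w)) ->
  (forall w, dotp Qst w = - (Phi A q B w + Phi p B B w + Phi p q Qtt w)) ->
  forall w, dotp p w = 0 -> dotp q w = 0 ->
  dotp (us *: a + u *: Pss + (vs *: A + v *: Pst) - (vs *: b + v *: Qss)
        + (us *: B + u *: Qst)) w
  = - Phi p q (ut *: a + u *: Pst + (vt *: A + v *: Ptt) - (vt *: b + v *: Qst)
        + (ut *: B + u *: Qtt)) w.
Proof.
move=> fr a0 usE utE hPss hPst hQss hQst w pw qw.
have A0 : A != 0.
  apply: contra_neq a0 => A0; apply: dotp_eq0.
  by rewrite -(iso_dotA fr) A0 dotp0r.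
(* This is the previous lemma in the coordinates (t, -s), which are holomorphic too. *)
have := @ruled_derivative_st p q A B (- a) (- b) Ptt (- Pst) Pss Qtt (- Qst) Qss
  v (- u) vt (- vs) (- ut) us (iso_rot fr) A0 _ _ _ _ _ _ w pw qw.
have h1 : vt = us by [].
have h2 : - vs = - - ut by rewrite opprK.
move=> /(_ h1 h2) h.
rewrite -[LHS]opprK -dotpNl; congr (- _).
have -> : - (us *: a + u *: Pss + (vs *: A + v *: Pst) - (vs *: b + v *: Qss)
        + (us *: B + u *: Qst)) =
   - vs *: A + v *: - Pst + (us *: - a + - u *: Pss) - (us *: B + - u *: - Qst)
        + (- vs *: - b + v *: Qss).
  by apply/rowP => i; rewrite !mxE; ring.
rewrite h.
- congr (Phi p q _ w).
  by apply/rowP => i; rewrite !mxE; ring.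
- by move=> z; rewrite dotpNl hPst opprK.
- by move=> z; rewrite hPss PhiN1 PhiN2 PhiNm; ring.
- by move=> z; rewrite dotpNl hQst opprK.
- by move=> z; rewrite hQss PhiN1 PhiN2 PhiNm; ring.
Qed.

(** [Pts] is the s-derivative of p_t and [Pst] the t-derivative of p_s. The factors 1 and -1 are the
    constant [c] of [derive_cross] for the two flat gauge equations. *)
Lemma ruled_derivative_conformal p q a b A B Pss Pst Pts Ptt Qss Qst Qts Qtt
    (u v us ut vs vt : R) Ys Yt :
  isotropic_frame p q a b A B -> a != 0 -> us = vt -> ut = - vs ->
  Pts = Pst -> Qts = Qst ->
  Ys = us *: a + u *: Pss + (vs *: A + v *: Pts) - (vs *: b + v *: Qss)
        + (us *: B + u *: Qts) ->
  Yt = ut *: a + u *: Pst + (vt *: A + v *: Ptt) - (vt *: b + v *: Qst)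
        + (ut *: B + u *: Qtt) ->
  (forall w, dotp Pts w = 1 * (Phi a q a w + Phi p b a w + Phi p q Pss w)) ->
  (forall w, dotp Ptt w = 1 * (Phi A q a w + Phi p B a w + Phi p q Pst w)) ->
  (forall w, dotp Qts w = 1 * (Phi a q b w + Phi p b b w + Phi p q Qss w)) ->
  (forall w, dotp Qtt w = 1 * (Phi A q b w + Phi p B b w + Phi p q Qst w)) ->
  (forall w, dotp Pss w = -1 * (Phi a q A w + Phi p b A w + Phi p q Pts w)) ->
  (forall w, dotp Pst w = -1 * (Phi A q A w + Phi p B A w + Phi p q Ptt w)) ->
  (forall w, dotp Qss w = -1 * (Phi a q B w + Phi p b B w + Phi p q Qts w)) ->
  (forall w, dotp Qst w = -1 * (Phi A q B w + Phi p B B w + Phi p q Qtt w)) ->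
  (forall w, dotp p w = 0 -> dotp q w = 0 -> dotp Yt w = Phi p q Ys w) /\
  (forall w, dotp p w = 0 -> dotp q w = 0 -> dotp Ys w = - Phi p q Yt w).
Proof.
move=> fr a0 cr1 cr2 -> -> -> -> P1 P2 Q1 Q2 P3 P4 Q3 Q4; split=> w pw qw.
- by apply: ruled_derivative_st => // z;
    rewrite ?P1 ?P2 ?Q1 ?Q2 mul1r.
- by apply: ruled_derivative_ts => // z;
    rewrite ?P3 ?P4 ?Q3 ?Q4 mulN1r.
Qed.

End RuledDerivative.

(** * Differential calculus *)

Section Derivatives.
Variables (R : realType) (V : normedModType R).
Implicit Types y d : V.

Lemma is_derive_coord n (f : V -> 'rV[R]_n) y d df i :
  is_derive y d f df -> is_derive y d (fun z => f z 0 i) (df 0 i).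
Proof.
move=> [fd <-]; have := (derivable_mxP f y d).1 fd 0 i => h.
by split=> //; rewrite derive_mx // mxE.
Qed.

Lemma is_derive_rV n (f : V -> 'rV[R]_n) y d (df : 'rV[R]_n) :
  (forall i, is_derive y d (fun z => f z 0 i) (df 0 i)) -> is_derive y d f df.
Proof.
move=> h; have fd : derivable f y d.
  by apply/derivable_mxP => i j; rewrite (ord1 i); apply: (@ex_derive _ _ _ _ _ _ _ (h j)).
split=> //; rewrite derive_mx //; apply/rowP => j; rewrite mxE.
exact: (@derive_val _ _ _ _ _ _ _ (h j)).
Qed.

Lemma is_derive_scale n (u : V -> R) (f : V -> 'rV[R]_n) y d du df :
  is_derive y d u du -> is_derive y d f df ->
  is_derive y d (fun z => u z *: f z) (du *: f y + u y *: df).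
Proof.
move=> ud fd; apply: is_derive_rV => i.
have fi := is_derive_coord i fd.
have -> : (fun z => (u z *: f z) 0 i) = u * (fun z => f z 0 i).
  by apply/funext => z; rewrite mxE.
apply: is_derive_eq; rewrite !mxE /GRing.scale /=; ring.
Qed.

Lemma is_derive_fsum n (h : 'I_n -> V -> R) y d (dh : 'I_n -> R) :
  (forall i, is_derive y d (h i) (dh i)) ->
  is_derive y d (fun z => \sum_(i < n) h i z) (\sum_(i < n) dh i).
Proof.
move=> hd; have -> : (fun z => \sum_(i < n) h i z) = \sum_(i < n) h i.
  by apply/funext => z; rewrite fct_sumE.
exact: is_derive_sum.
Qed.

Lemma is_derive_fmul (f g : V -> R) y d df dg :
  is_derive y d f df -> is_derive y d g dg ->
  is_derive y d (fun z => f z * g z) (df * g y + f y * dg).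
Proof.
move=> fd gd; have -> : (fun z => f z * g z) = f * g by [].
by apply: is_derive_eq; rewrite /GRing.scale /=; ring.
Qed.

Lemma is_derive_ext (W : normedModType R) (f g : V -> W) y d df :
  f =1 g -> is_derive y d f df -> is_derive y d g df.
Proof. by move=> /funext ->. Qed.

Lemma is_derive_lin T (f : V -> 'rV[R]_8) y d df : linear_form T ->
  is_derive y d f df -> is_derive y d (fun z => T (f z)) (T df).
Proof.
move=> TL fd; rewrite (linear_formE TL df).
apply: (@is_derive_ext _ (fun z => \sum_i f z 0 i * T (delta_mx 0 i))).
  by move=> z; rewrite -linear_formE.
apply: is_derive_fsum => i; have fi := is_derive_coord i fd.
have := is_derive_fmul fi (is_derive_cst (T (delta_mx 0 i)) y d).
by rewrite mulr0 addr0.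
Qed.

(** Expanding the first argument in the standard basis leaves products of a scalar function and a
    linear form; the trilinear rule is reduced to this one in the same way. *)
Lemma is_derive_bilin (T : 'rV[R]_8 -> 'rV[R]_8 -> R) (f g : V -> 'rV[R]_8) y d df dg :
  (forall u, linear_form (T u)) -> (forall u, linear_form (T^~ u)) ->
  is_derive y d f df -> is_derive y d g dg ->
  is_derive y d (fun z => T (f z) (g z)) (T df (g y) + T (f y) dg).
Proof.
move=> T1 T2 fd gd.
rewrite (linear_formE (T2 (g y)) df) (linear_formE (T2 dg) (f y)) -big_split.
apply: (@is_derive_ext _ (fun z => \sum_i f z 0 i * T (delta_mx 0 i) (g z))).
  by move=> z; rewrite -(linear_formE (T2 (g z))).
apply: is_derive_fsum => i; apply: is_derive_fmul; first exact: is_derive_coord.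
exact: is_derive_lin.
Qed.

Lemma is_derive_trilin (T : 'rV[R]_8 -> 'rV[R]_8 -> 'rV[R]_8 -> R)
    (f g h : V -> 'rV[R]_8) y d df dg dh :
  (forall u v, linear_form (T u v)) -> (forall u v, linear_form (T u ^~ v)) ->
  (forall u v, linear_form (fun z => T z u v)) ->
  is_derive y d f df -> is_derive y d g dg -> is_derive y d h dh ->
  is_derive y d (fun z => T (f z) (g z) (h z))
    (T df (g y) (h y) + T (f y) dg (h y) + T (f y) (g y) dh).
Proof.
move=> T1 T2 T3 fd gd hd.
rewrite -addrA (linear_formE (T3 (g y) (h y)) df) (linear_formE (T3 dg (h y)) (f y)).
rewrite (linear_formE (T3 (g y) dh) (f y)) -!big_split /=.
apply: (@is_derive_ext _ (fun z => \sum_i f z 0 i * T (delta_mx 0 i) (g z) (h z))).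
  by move=> z; rewrite -(linear_formE (T3 (g z) (h z))).
apply: is_derive_fsum => i; rewrite -mulrDr; apply: is_derive_fmul.
  exact: is_derive_coord.
exact: is_derive_bilin.
Qed.

End Derivatives.

Section DerivativeTransport.
Variables (R : realType) (V V' W : normedModType R).

(** A directional derivative sees only a line. This replaces derivatives of [iotaM] and [link] on
    product spaces by derivatives in a chart or in one real variable. *)
Lemma derive_along (f : V -> W) (g : V' -> W) a v b u :
  (forall h : R, f (h *: v + a) = g (h *: u + b)) -> 'D_v f a = 'D_u g b.
Proof.
move=> fg; rewrite /derive.
have -> // : (fun h : R => h^-1 *: ((f \o shift a) (h *: v) - f a))
   = (fun h : R => h^-1 *: ((g \o shift b) (h *: u) - g b)).
apply/funext => h /=.
by rewrite fg; have := fg 0; rewrite !scale0r !add0r => ->.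
Qed.

Lemma near_eq_differentiable (f g : V -> W) a :
  {near a, f =1 g} -> differentiable f a -> differentiable g a.
Proof.
move=> fg df; have [dfc e] := (diff_locallyP _ _).1 df.
have ga : g a = f a by rewrite (nbhs_singleton fg).
have eg : g \o shift a = cst (g a) + 'd f a +o_ 0 id.
  apply/eqaddoP => _/posnumP[eps]; have /eqaddoP/(_ eps%:num (gt0 _)) := e.
  apply: filterS2; last first.
    by have := fg; rewrite (near_shift 0 a) subr0; apply.
  by move=> x /= fgx; rewrite -[(_ + _ : _ -> _) x]/(_ + _) ga; rewrite !fctE /= fgx.
by apply/diff_locallyP; rewrite (diff_unique dfc eg).
Qed.

End DerivativeTransport.

Section SmoothOn.
Variables (R : realType) (U : set (R * R)).
Hypothesis Uo : open U.
Implicit Types V : normedModType R.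

Lemma open_near_eq V (f g : R * R -> V) p :
  (forall z, U z -> f z = g z) -> U p -> {near p, f =1 g}.
Proof.
by move=> fg Up; apply: (filterS fg); exact: open_nbhs_nbhs.
Qed.

Lemma Ck_eq V k (f g : R * R -> V) :
  (forall p, U p -> f p = g p) -> Ck k U f -> Ck k U g.
Proof.
elim: k f g => [|k IH] f g fg /=.
  move=> fc p Up; rewrite /prop_for /continuous_at -fg //.
  apply: cvg_trans (fc p Up); apply: near_eq_cvg.
  exact: open_near_eq.
move=> [fd fs ft]; split.
- by move=> p Up; apply: near_eq_differentiable (fd p Up); exact: open_near_eq.
- by apply: IH fs => p Up; apply: near_eq_derive; exact: open_near_eq.
- by apply: IH ft => p Up; apply: near_eq_derive; exact: open_near_eq.
Qed.

Lemma smooth_on_eq V (f g : R * R -> V) :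
  (forall p, U p -> f p = g p) -> smooth_on U f -> smooth_on U g.
Proof. by move=> fg fs k; apply: Ck_eq fg (fs k). Qed.

Lemma smooth_on_diff V (f : R * R -> V) p : smooth_on U f -> U p -> differentiable f p.
Proof. by move=> fs; have [+ _ _] := fs 1; apply. Qed.

Lemma smooth_on_derive V (f : R * R -> V) d : smooth_on U f -> d = ds \/ d = dt ->
  smooth_on U ('D_d f).
Proof. by move=> fs dE k; have [_ h1 h2] := fs k.+1; case: dE => ->. Qed.

Lemma smooth_on_is_derive V (f : R * R -> V) p d : smooth_on U f -> U p ->
  is_derive p d f ('D_d f p).
Proof. by move=> fs Up; apply/derivableP/diff_derivable/smooth_on_diff. Qed.

Lemma CkD V k (f g : R * R -> V) :
  Ck k U f -> Ck k U g -> Ck k U (fun z => f z + g z).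
Proof.
elim: k f g => [|k IH] f g /=.
  by move=> fc gc p Up; apply: cvgD; [exact: fc|exact: gc].
move=> [fd fs ft] [gd gs gt].
have De d p : U p -> 'D_d f p + 'D_d g p = 'D_d (fun z => f z + g z) p.
  by move=> Up; rewrite -deriveD //; apply: diff_derivable; auto.
split.
- by move=> p Up; apply: differentiableD; auto.
- by apply: Ck_eq (De ds) _; apply: IH.
- by apply: Ck_eq (De dt) _; apply: IH.
Qed.

Lemma smooth_onD V (f g : R * R -> V) :
  smooth_on U f -> smooth_on U g -> smooth_on U (fun z => f z + g z).
Proof. by move=> fs gs k; apply: CkD. Qed.

Lemma smooth_onN V (f : R * R -> V) :
  smooth_on U f -> smooth_on U (fun z => - f z).
Proof.
move=> fs k; elim: k f fs => [|k IH] f fs /=.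
  by move=> p Up; apply: cvgN; exact: fs 0 p Up.
have De d p : U p -> - 'D_d f p = 'D_d (fun z => - f z) p.
  move=> Up; rewrite -deriveN //; exact/diff_derivable/smooth_on_diff.
split.
- by move=> p Up; apply: differentiableN; exact: smooth_on_diff.
- by apply: Ck_eq (De ds) _; apply: IH; apply: smooth_on_derive; auto.
- by apply: Ck_eq (De dt) _; apply: IH; apply: smooth_on_derive; auto.
Qed.

Lemma differentiable_scale_rV n (u : R * R -> R) (f : R * R -> 'rV[R]_n) p :
  differentiable u p -> differentiable f p -> differentiable (fun z => u z *: f z) p.
Proof.
move=> ud fd.
have -> : (fun z => u z *: f z) =
    \sum_(i < n) (fun z => (u z * f z 0 i) *: (delta_mx 0 i : 'rV[R]_n)).
  apply/funext => z; rewrite fct_sumE {1}(row_sum_delta (f z)) scaler_sumr.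
  by apply: eq_bigr => i _; rewrite scalerA.
apply: differentiable_sum => i; apply: differentiableZl.
apply: differentiableM => //.
apply: (@differentiable_comp _ _ _ _ f (fun M : 'rV[R]_n => M 0 i)) => //.
exact: differentiable_coord.
Qed.

Lemma smooth_onZ n (u : R * R -> R) (f : R * R -> 'rV[R]_n) :
  smooth_on U u -> smooth_on U f -> smooth_on U (fun z => u z *: f z).
Proof.
move=> us fs k; elim: k u f us fs => [|k IH] u f us fs /=.
  move=> p Up; apply: differentiable_continuous.
  by apply: differentiable_scale_rV; exact: smooth_on_diff.
have De d p : U p -> 'D_d u p *: f p + u p *: 'D_d f p = 'D_d (fun z => u z *: f z) p.
  move=> Up.
  have ud := smooth_on_is_derive d us Up; have fd := smooth_on_is_derive d fs Up.
  by have := is_derive_scale ud fd => -[_ ->].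
have DC d : d = ds \/ d = dt -> Ck k U ('D_d (fun z => u z *: f z)).
  move=> dE; apply: Ck_eq (De d) _; apply: CkD; apply: IH => //;
  exact: smooth_on_derive.
split; [|by apply: DC; left|by apply: DC; right].
by move=> p Up; apply: differentiable_scale_rV; exact: smooth_on_diff.
Qed.

Lemma derive_linear (V W : normedModType R) (L : {linear V -> W}) (f : R * R -> V) p d :
  continuous L -> differentiable f p ->
  differentiable (L \o f) p /\ 'D_d (L \o f) p = L ('D_d f p).
Proof.
move=> Lc fd; have Ld : differentiable L (f p) by apply: linear_differentiable.
have cd : differentiable (L \o f) p by apply: differentiable_comp.
split=> //; rewrite !deriveE // diff_comp //= diff_lin //.
Qed.

Lemma smooth_on_linear (V W : normedModType R) (L : {linear V -> W}) (f : R * R -> V) :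
  continuous L -> smooth_on U f -> smooth_on U (L \o f).
Proof.
move=> Lc fs k; elim: k f fs => [|k IH] f fs /=.
  move=> p Up; apply: differentiable_continuous.
  by have [] := derive_linear ds Lc (smooth_on_diff fs Up).
have De d p : U p -> (L \o 'D_d f) p = 'D_d (L \o f) p.
  by move=> Up; have [_ ->] := derive_linear d Lc (smooth_on_diff fs Up).
split.
- by move=> p Up; have [] := derive_linear ds Lc (smooth_on_diff fs Up).
- by apply: Ck_eq (De ds) _; apply: IH; apply: smooth_on_derive; auto.
- by apply: Ck_eq (De dt) _; apply: IH; apply: smooth_on_derive; auto.
Qed.

Lemma smooth_on_fst (f : R * R -> R * R) : smooth_on U f ->
  smooth_on U (fun z => (f z).1).
Proof. by apply: (@smooth_on_linear _ _ fst) => z; exact: cvg_fst. Qed.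

Lemma smooth_on_snd (f : R * R -> R * R) : smooth_on U f ->
  smooth_on U (fun z => (f z).2).
Proof. by apply: (@smooth_on_linear _ _ snd) => z; exact: cvg_snd. Qed.

Lemma derive_fst (f : R * R -> R * R) p d : differentiable f p ->
  'D_d (fun z => (f z).1) p = ('D_d f p).1.
Proof.
by move=> fd; have [] := @derive_linear _ _ fst f p d _ fd => // z; exact: cvg_fst.
Qed.

Lemma derive_snd (f : R * R -> R * R) p d : differentiable f p ->
  'D_d (fun z => (f z).2) p = ('D_d f p).2.
Proof.
by move=> fd; have [] := @derive_linear _ _ snd f p d _ fd => // z; exact: cvg_snd.
Qed.

End SmoothOn.

(** * Symmetry of the mixed second derivatives *)

Section MixedPartials.
Variable R : realType.

Lemma is_derive_slice1 (f : R * R -> R) x y l :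
  is_derive (x, y) ds f l -> is_derive x 1 (fun t => f (t, y)) l.
Proof.
have e : (fun h : R => h^-1 *: ((f \o shift (x, y)) (h *: ds) - f (x, y))) =
   (fun h : R => h^-1 *: (((fun t => f (t, y)) \o shift x) (h *: 1) - f (x, y))).
  apply/funext => h /=; congr (_ *: (f _ - _)).
  change (h *: ds + (x, y)) with (h *: (1 : R) + x, h * 0 + y).
  by rewrite mulr0 add0r.
by move=> [fd fl]; split; rewrite /derivable /derive -e.
Qed.

Lemma is_derive_slice2 (f : R * R -> R) x y l :
  is_derive (x, y) dt f l -> is_derive y 1 (fun t => f (x, t)) l.
Proof.
have e : (fun h : R => h^-1 *: ((f \o shift (x, y)) (h *: dt) - f (x, y))) =
   (fun h : R => h^-1 *: (((fun t => f (x, t)) \o shift y) (h *: 1) - f (x, y))).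
  apply/funext => h /=; congr (_ *: (f _ - _)).
  change (h *: dt + (x, y)) with (h * 0 + x, h *: (1 : R) + y).
  by rewrite mulr0 add0r.
by move=> [fd fl]; split; rewrite /derivable /derive -e.
Qed.

Lemma MVT_is_derive (f df : R -> R) (a b : R) : a < b ->
  (forall x, a <= x <= b -> is_derive x 1 f (df x)) ->
  exists2 c, a < c < b & f b - f a = df c * (b - a).
Proof.
move=> ab fd; have [||c cab ->] := @MVT R f df a b ab.
- by move=> x; rewrite in_itv /= => /andP[ax xb]; apply: fd; rewrite !ltW.
- apply: derivable_within_continuous => x; rewrite in_itv /= => xab.
  by have [] := fd x xab.
- by exists c => //; rewrite in_itv /= in cab.
Qed.

(** The mean value theorem is applied in s to f(s, y + h) - f(s, y), then in t to [fs] at the point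
    so found. *)
Lemma mixed_increment (f fs fst : R -> R -> R) (x y h : R) : 0 < h ->
  (forall s t, x <= s <= x + h -> y <= t <= y + h -> is_derive s 1 (f ^~ t) (fs s t)) ->
  (forall s t, x <= s <= x + h -> y <= t <= y + h -> is_derive t 1 (fs s) (fst s t)) ->
  exists s t, [/\ x <= s <= x + h, y <= t <= y + h &
   f (x + h) (y + h) - f x (y + h) - f (x + h) y + f x y = fst s t * h * h].
Proof.
move=> h0 fd fsd; have xh : x < x + h by rewrite ltrDl.
have yh : y < y + h by rewrite ltrDl.
have yy : y <= y <= y + h by rewrite lexx ltW.
have yhyh : y <= y + h <= y + h by rewrite lexx ltW.
have [s sx e1] := @MVT_is_derive (f ^~ (y + h) - f ^~ y)
  (fun s => fs s (y + h) - fs s y) x (x + h) xh (fun s sx =>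
  is_deriveB (fd s _ sx yhyh) (fd s _ sx yy)).
have {}sx : x <= s <= x + h by case/andP: sx => *; rewrite !ltW.
have [t ty e2] := @MVT_is_derive (fs s) (fst s) y (y + h) yh
  (fun t ty => fsd s t sx ty).
have {}ty : y <= t <= y + h by case/andP: ty => *; rewrite !ltW.
exists s, t; split=> //; move: e1; rewrite e2 !(addrC _ h) !addrK => <-.
by rewrite !fctE; ring.
Qed.

Lemma mixed_partials (f fs ft fst fts : R * R -> R) (p : R * R) :
  (\forall z \near p, is_derive z ds f (fs z)) ->
  (\forall z \near p, is_derive z dt f (ft z)) ->
  (\forall z \near p, is_derive z dt fs (fst z)) ->
  (\forall z \near p, is_derive z ds ft (fts z)) ->
  {for p, continuous fst} -> {for p, continuous fts} -> fst p = fts p.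
Proof.
move=> fsd ftd fstd ftsd cst cts; apply/eqP; apply: contraT => ne.
(* With a third of the gap, two errors below [e] cannot add up to the gap. *)
pose e := `|fst p - fts p| / 3.
have e0 : 0 < e by rewrite divr_gt0 // normr_gt0 subr_eq0.
have c1 : \forall z \near p, `|fst p - fst z| < e.
  by move/cvgrPdist_lt : cst => /(_ _ e0).
have c2 : \forall z \near p, `|fts p - fts z| < e.
  by move/cvgrPdist_lt : cts => /(_ _ e0).
have N : \forall z \near p, (is_derive z ds f (fs z) /\ is_derive z dt f (ft z)) /\
    (is_derive z dt fs (fst z) /\ is_derive z ds ft (fts z)) /\
    (`|fst p - fst z| < e /\ `|fts p - fts z| < e).
  by near=> z; split; [split|split; split]; near: z.
have [r /= r0 br] := (nbhs_ballP _ _).1 N.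
(* Half the radius keeps the closed square of side [h] inside the open ball. *)
pose h := r / 2; have h0 : 0 < h by rewrite divr_gt0.
have B s t : p.1 <= s <= p.1 + h -> p.2 <= t <= p.2 + h -> ball p r (s, t).
  move=> /andP[s1 s2] /andP[t1 t2].
  have hr : h < r by rewrite /h ltr_pdivrMr // ltr_pMr // ltr1n.
  by split; rewrite /ball /= ltr_norml; apply/andP; split; lra.
have [s [t [sx ty e1]]] := @mixed_increment (fun s t => f (s, t)) (fun s t => fs (s, t))
  (fun s t => fst (s, t)) p.1 p.2 h h0
  (fun s t sx ty => is_derive_slice1 (br _ (B _ _ sx ty)).1.1)
  (fun s t sx ty => is_derive_slice2 (br _ (B _ _ sx ty)).2.1.1).
(* The second increment over a square is symmetric in s and t, so it is also a value of [fts] times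
   h^2. *)
have [t' [s' [ty' sx' e2]]] := @mixed_increment (fun t s => f (s, t)) (fun t s => ft (s, t))
  (fun t s => fts (s, t)) p.2 p.1 h h0
  (fun t s ty sx => is_derive_slice2 (br _ (B _ _ sx ty)).1.2)
  (fun t s ty sx => is_derive_slice1 (br _ (B _ _ sx ty)).2.1.2).
have e12 : fst (s, t) = fts (s', t').
  apply: (mulIf (lt0r_neq0 h0)); apply: (mulIf (lt0r_neq0 h0)).
  by rewrite -e1 -e2; ring.
have d1 := (br _ (B _ _ sx ty)).2.2.1; have d2 := (br _ (B _ _ sx' ty')).2.2.2.
have : `|fst p - fts p| < e + e.
  rewrite -(subrKA (fst (s, t))) {2}e12 (le_lt_trans (ler_normD _ _)) // ltrD //.
  by rewrite distrC.
rewrite /e; have := normr_ge0 (fst p - fts p); set m := `| _ |; lra.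
Unshelve. all: by end_near. Qed.

End MixedPartials.

(** * Real directional derivatives of holomorphic maps *)

Section Holomorphic.
Variable R : realType.
Implicit Types z w : R[i].
Local Notation normc := ComplexField.Normc.normc.

Lemma normr_normc z : `|z| = real_complex R (normc z).
Proof. by case: z. Qed.

Lemma normr_ofC_le z : `|ofC z| <= normc z.
Proof.
case: z => a b; rewrite /ofC /= [`|_|]/Num.norm /= ge_max; apply/andP.
by split; rewrite -sqrtr_sqr ler_wsqrtr // ?lerDl ?lerDr sqr_ge0.
Qed.

Lemma normc_real (h : R) : normc (real_complex R h) = `|h|.
Proof. by rewrite /= expr0n /= addr0 sqrtr_sqr. Qed.

Lemma toCB (u v : R * R) : toC (u - v) = toC u - toC v.
Proof. by []. Qed.

Lemma toCD (u v : R * R) : toC (u + v) = toC u + toC v.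
Proof. by []. Qed.

Lemma toCZ (h : R) (v : R * R) : toC (h *: v) = real_complex R h * toC v.
Proof.
by apply/eqP; rewrite eq_complex /= /GRing.scale /=; apply/andP; split; apply/eqP; ring.
Qed.

Lemma toCK : cancel (@toC R) (@ofC R).
Proof. by case. Qed.

Lemma ofCB z w : ofC (z - w) = ofC z - ofC w.
Proof. by case: z => ? ?; case: w. Qed.

(** The real difference quotient along v at h is the complex one at the increment h c, multiplied by
    c = [toC v]; the sup norm of the plane is at most the complex modulus. *)
Lemma holomorphic_is_derive (f : R * R -> R * R) p : holomorphic_at f p ->
  exists l : R[i], forall v, is_derive p v f (ofC (l * toC v)).
Proof.
rewrite /holomorphic_at => /cvg_ex[/= l /cvgrPdist_lt fl]; exists l => v.
have [->|v0] := eqVneq v 0.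
  have -> : ofC (l * toC 0) = 0; last exact: is_derive0.
  by rewrite /toC /= mulr0.
have [c cE] : exists c, c = toC v by exists (toC v).
have c0 : c != 0.
  apply: contra_neq v0; rewrite cE => /eqP; rewrite eq_complex /= => /andP[/eqP v1 /eqP v2].
  by rewrite (surjective_pairing v) v1 v2.
have nc0 : 0 < normc c.
  have : 0 < `|c| by rewrite normr_gt0.
  by rewrite normr_normc ltcR.
rewrite -cE; suff fv :
    (fun h : R => h^-1 *: ((f \o shift p) (h *: v) - f p)) @ 0^' --> ofC (l * c).
  by split; [apply/cvg_ex; exists (ofC (l * c))|exact: cvg_lim].
apply/cvgrPdist_lt => e e0.
(* The later multiplication by c costs a factor |c|, hence the tolerance e / |c|; the increment h c
   likewise forces the radius r' / |c|. *)
have e1 : 0 < real_complex R (e / normc c) by rewrite ltcR divr_gt0.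
have [/= r r0 fr] := fl _ e1.
(* A positive element of R[i] is real. *)
have [r' r'E] : exists r', r = real_complex R r'.
  by exists (complex.Re r); move: r0; case: (r) => a b; rewrite ltcE /= => /andP[/eqP ->].
rewrite {}r'E ltcR in r0 fr.
exists (r' / normc c) => /=; first by rewrite divr_gt0.
move=> h /=; rewrite sub0r normrN ltr_pdivlMr // => hr h0.
pose k := real_complex R h * c.
have k0 : k != 0 by rewrite mulf_neq0 // eq_complex /= (negbTE h0).
pose G := k^-1 * (toC (f (ofC (k + toC p))) - toC (f p)).
have Glt : normc (l - G) < e / normc c.
  have := fr k; rewrite /ball_ /= sub0r normrN normr_normc ltcR.
  rewrite ComplexField.Normc.normcM normc_real => /(_ hr k0).
  by rewrite [k%:A]mulr1 toCK normr_normc ltcR.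
rewrite ltr_pdivlMr // -ComplexField.Normc.normcM in Glt.
apply: le_lt_trans Glt; apply: le_trans (normr_ofC_le _).
have -> : (l - G) * c = l * c - toC (h^-1 *: (f (h *: v + p) - f p)).
  rewrite mulrBl; congr (_ - _).
  rewrite /G /k cE -toCZ -toCD toCK -toCB [in RHS]toCZ toCZ -cE.
  have -> : real_complex R h^-1 = (real_complex R h)^-1 by rewrite fmorphV.
  by rewrite invfM -[RHS]mul1r -(mulVf c0); ring.
by rewrite ofCB toCK.
Qed.

End Holomorphic.

(** * Charts *)

(* The unqualified name denotes [vector.coord]. *)
Local Notation coord := Defs.coord.

(** The inner map is only derivable along d, which is how chart transitions are known here; its
    restriction to the line through a is differentiable in one variable, and the chain rule is
    applied to that. *)
Lemma derive_chain (R : realType) (V V' W : normedModType R) (g : V -> V') (F : V' -> W)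
    a d : derivable g a d -> differentiable F (g a) ->
  'D_d (F \o g) a = 'D_('D_d g a) F (g a).
Proof.
move=> gd Fd; pose c (h : R) := g (h *: d + a).
have along (X : normedModType R) (k : V -> X) :
    'D_d k a = 'D_1 (fun h : R => k (h *: d + a)) 0.
  by apply: derive_along => h; rewrite addr0 [h%:A]mulr1.
have c0 : c 0 = g a by rewrite /c scale0r add0r.
have cd : differentiable c 0 by apply/derivable1_diffP; exact: (derivable1P g a d).1.
have Fc : differentiable F (c 0) by rewrite c0.
have gE : 'D_d g a = 'd c 0 1 by rewrite along deriveE.
have FE : 'D_d (F \o g) a = 'd (F \o c) 0 1.
  by rewrite along -deriveE //; exact: differentiable_comp.
by rewrite FE diff_comp // gE -c0 deriveE.
Qed.

Lemma derive_pair_dir (R : realType) (W : normedModType R) (F : R * R -> W) p (d : R * R) :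
  differentiable F p -> 'D_d F p = d.1 *: 'D_ds F p + d.2 *: 'D_dt F p.
Proof.
move=> Fd; rewrite !deriveE // -!linearZ -linearD; congr ('d F p _).
case: d => x y; rewrite /ds /dt; congr pair => /=.
  by rewrite /GRing.scale /= mulr0 mulr1 addr0.
by rewrite /GRing.scale /= mulr0 mulr1 add0r.
Qed.

Section Charts.
Variables (R : realType) (S : riemannSurface R).
Implicit Types (i j : idx S) (x : S).

Definition cimg i : set (R * R) := coord (ch i) @` cdom (ch i).

Lemma cimg_cinv i y : cimg i y ->
  cdom (ch i) (cinv (ch i) y) /\ coord (ch i) (cinv (ch i) y) = y.
Proof. by move=> [x ix <-]; rewrite coordK. Qed.

Lemma derive_chart_change (V : normedModType R) (f : S -> V) i j x (d : R * R) :
  smooth f -> cdom (ch i) x -> cdom (ch j) x ->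
  'D_d (loc i f) (coord (ch i) x) =
  'D_('D_d (coord (ch j) \o cinv (ch i)) (coord (ch i) x)) (loc j f) (coord (ch j) x).
Proof.
move=> fs ix jx; set c := coord (ch i) x; set tau := coord (ch j) \o cinv (ch i).
have ci : cimg i c by exists x.
have tc : tau c = coord (ch j) x by rewrite /tau /= coordK.
have near_tau : {near c, loc i f =1 loc j f \o tau}.
  have : \forall z \near c, cdom (ch j) (cinv (ch i) z).
    apply: (@cinv_cont _ _ (ch i) c ci); rewrite coordK //.
    by apply: open_nbhs_nbhs; split=> //; exact: cdom_open.
  by apply: filterS => z jz; rewrite /loc /tau /= coordK.
have [l tl] : exists l : R[i], forall v, is_derive c v tau (ofC (l * toC v)).
  by apply/holomorphic_is_derive/ch_holo; exists x.
have td : derivable tau c d by have [] := tl d.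
rewrite (near_eq_derive d near_tau) derive_chain // ?tc //.
by apply: (smooth_on_diff (fs j)); exists x.
Qed.

Variable w : tangent_field S.
Hypothesis w_holo : holomorphic_vector_field w.

(** For [imul w] the point is that the derivative of a transition map is multiplication by a complex
    number and so commutes with i. *)
Lemma Lie_chart (V : normedModType R) (f : S -> V) i x : smooth f -> cdom (ch i) x ->
  Lie w f x = 'D_(w i x) (loc i f) (coord (ch i) x) /\
  Lie (imul w) f x = 'D_(imul w i x) (loc i f) (coord (ch i) x).
Proof.
move=> fs ix; rewrite /Lie; set j := chart_at x.
have jx : cdom (ch j) x by rewrite /j /chart_at; case: cid.
have [[wt _] _] := w_holo.
rewrite !(derive_chart_change _ fs jx ix) -(wt _ _ _ jx ix).
suff -> : 'D_(imul w j x) (coord (ch i) \o cinv (ch j)) (coord (ch j) x) = imul w i x by [].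
have [l tl] : exists l : R[i], forall v, is_derive (coord (ch j) x) v
    (coord (ch i) \o cinv (ch j)) (ofC (l * toC v)).
  by apply/holomorphic_is_derive/ch_holo; exists x.
have [_ ->] := tl (imul w j x).
rewrite /imul (wt _ _ _ jx ix); have [_ ->] := tl (w j x).
by case: (l) => l1 l2; rewrite /ofC /toC /=; congr pair; ring.
Qed.

Definition wu i (y : R * R) : R := (loc i (w i) y).1.
Definition wv i (y : R * R) : R := (loc i (w i) y).2.

Lemma cauchy_riemann i y : cimg i y ->
  'D_ds (wu i) y = 'D_dt (wv i) y /\ 'D_dt (wu i) y = - 'D_ds (wv i) y.
Proof.
move=> iy; have [[_ ws] wh] := w_holo.
have [l wl] := holomorphic_is_derive (wh i y iy).
have wd : differentiable (loc i (w i)) y by apply: (smooth_on_diff (ws i)).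
rewrite !derive_fst // !derive_snd //.
have [_ ->] := wl ds; have [_ ->] := wl dt.
by case: (l) => l1 l2; rewrite /ofC /toC /ds /dt /=; split; ring.
Qed.

Lemma smooth_wu i : smooth_on (cimg i) (wu i).
Proof. by have [[_ ws] _] := w_holo; apply: smooth_on_fst (ws i); exact: cimg_open. Qed.

Lemma smooth_wv i : smooth_on (cimg i) (wv i).
Proof. by have [[_ ws] _] := w_holo; apply: smooth_on_snd (ws i); exact: cimg_open. Qed.

Variables phi1 phi2 : S -> 'rV[R]_8.
Hypotheses (s1 : smooth phi1) (s2 : smooth phi2).

Definition psi_field x : 'rV[R]_8 := Lie w phi1 x + Lie (imul w) phi2 x.

Definition psi_chart i (y : R * R) : 'rV[R]_8 :=
  wu i y *: 'D_ds (loc i phi1) y + wv i y *: 'D_dt (loc i phi1) y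
  - wv i y *: 'D_ds (loc i phi2) y + wu i y *: 'D_dt (loc i phi2) y.

Lemma psi_chartE i y : cimg i y -> loc i psi_field y = psi_chart i y.
Proof.
move=> iy; have [ix yE] := cimg_cinv iy; rewrite /psi_field /loc /=.
have [-> _] := Lie_chart s1 ix; have [_ ->] := Lie_chart s2 ix.
have d1 : differentiable (loc i phi1) y by exact: (smooth_on_diff (s1 i)).
have d2 : differentiable (loc i phi2) y by exact: (smooth_on_diff (s2 i)).
rewrite yE (derive_pair_dir (w i _) d1) (derive_pair_dir (imul w i _) d2).
by rewrite /psi_chart /imul /wu /wv /loc /= scaleNr !addrA.
Qed.

Lemma smooth_psi_chart i : smooth_on (cimg i) (psi_chart i).
Proof.
have Uo : open (cimg i) by exact: cimg_open.
have sD (f : S -> 'rV[R]_8) d : smooth f -> d = ds \/ d = dt ->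
    smooth_on (cimg i) ('D_d (loc i f)).
  by move=> fs dE; apply: smooth_on_derive (fs i) dE.
apply: smooth_onD => //; last by apply: smooth_onZ => //; [exact: smooth_wu|apply: sD; auto].
apply: smooth_onD => //.
  by apply: smooth_onD => //; apply: smooth_onZ => //;
    [exact: smooth_wu|apply: sD; auto|exact: smooth_wv|apply: sD; auto].
by apply: smooth_onN => //; apply: smooth_onZ => //; [exact: smooth_wv|apply: sD; auto].
Qed.

Lemma smooth_psi : smooth psi_field.
Proof.
move=> i; apply: smooth_on_eq (smooth_psi_chart i); first exact: cimg_open.
by move=> y iy; rewrite psi_chartE.
Qed.

Lemma is_derive_psi i y d : cimg i y ->
  is_derive y d (loc i psi_field)
   ('D_d (wu i) y *: 'D_ds (loc i phi1) y + wu i y *: 'D_d ('D_ds (loc i phi1)) y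
    + ('D_d (wv i) y *: 'D_dt (loc i phi1) y + wv i y *: 'D_d ('D_dt (loc i phi1)) y)
    - ('D_d (wv i) y *: 'D_ds (loc i phi2) y + wv i y *: 'D_d ('D_ds (loc i phi2)) y)
    + ('D_d (wu i) y *: 'D_dt (loc i phi2) y + wu i y *: 'D_d ('D_dt (loc i phi2)) y)).
Proof.
move=> iy; apply: (@near_eq_is_derive _ _ _ (psi_chart i)).
  apply: (@open_near_eq _ (cimg i)) iy; first exact: cimg_open.
  by move=> z iz; rewrite psi_chartE.
have sc (u : R * R -> R) (f : S -> 'rV[R]_8) e : smooth_on (cimg i) u -> smooth f ->
    e = ds \/ e = dt -> is_derive y d (fun z => u z *: 'D_e (loc i f) z)
     ('D_d u y *: 'D_e (loc i f) y + u y *: 'D_d ('D_e (loc i f)) y).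
  move=> us fs eE; apply: is_derive_scale; first exact: smooth_on_is_derive us iy.
  exact: smooth_on_is_derive (smooth_on_derive (fs i) eE) iy.
have t1 := sc _ _ ds (@smooth_wu i) s1 (or_introl erefl).
have t2 := sc _ _ dt (@smooth_wv i) s1 (or_intror erefl).
have t3 := sc _ _ ds (@smooth_wv i) s2 (or_introl erefl).
have t4 := sc _ _ dt (@smooth_wu i) s2 (or_intror erefl).
exact (is_deriveD (is_deriveB (is_deriveD t1 t2) t3) t4).
Qed.

End Charts.

(** The angle is acos(x / rho), with the sign of y. *)
Lemma polar_coordinates (R : realType) (x y : R) : (x, y) != 0 ->
  exists rho theta : R, [/\ 0 < rho, x = rho * cos theta & y = rho * sin theta].
Proof.
move=> xy0; have s0 : 0 < x ^+ 2 + y ^+ 2.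
  rewrite lt_neqAle addr_ge0 ?sqr_ge0 // andbT eq_sym.
  apply: contra_neq xy0 => /eqP; rewrite paddr_eq0 ?sqr_ge0 // !sqrf_eq0.
  by move=> /andP[/eqP -> /eqP ->].
pose rho := Num.sqrt (x ^+ 2 + y ^+ 2); have r0 : 0 < rho by rewrite sqrtr_gt0.
have r2 : rho ^+ 2 = x ^+ 2 + y ^+ 2 by rewrite sqr_sqrtr // ltW.
pose t := x / rho.
have t2 : 1 - t ^+ 2 = (y / rho) ^+ 2.
  by rewrite /t !expr_div_n r2; field; rewrite gt_eqF.
have tb : -1 <= t <= 1.
  by rewrite -ler_norml -(@expr_le1 _ 2) // real_normK ?num_real // -subr_ge0 t2 sqr_ge0.
have sa : sin (acos t) = `|y| / rho.
  by rewrite sin_acos // t2 sqrtr_sqr normrM normfV (gtr0_norm r0).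
have [y0|y0] := leP 0 y.
  exists rho, (acos t); split=> //.
    by rewrite acosK ?in_itv //= /t mulrC divfK ?gt_eqF.
  by rewrite sa (ger0_norm y0) mulrC divfK ?gt_eqF.
exists rho, (- acos t); split=> //.
  by rewrite cosN acosK ?in_itv //= /t mulrC divfK ?gt_eqF.
by rewrite sinN sa (ltr0_norm y0) mulNr opprK mulrC divfK ?gt_eqF.
Qed.

Lemma row_free_row_neq0 (F : fieldType) m n (A : 'M[F]_(m, n)) i :
  row_free A -> row i A != 0.
Proof.
move=> fA; apply/eqP; rewrite rowE -(mul0mx _ A) => /(row_free_inj fA) /rowP/(_ i).
by rewrite !mxE !eqxx => /eqP; rewrite oner_eq0.
Qed.

(** * Tangent vectors in a chart *)

Section Frames.
Variables (R : realType) (S : riemannSurface R).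
Implicit Types (i : idx S) (x : S).

Lemma derive_affine n (p C : 'rV[R]_n) :
  'D_1 (fun h : R => h *: p + C) 0 = p.
Proof.
have h1 := is_derive_scale (is_derive_id (0 : R) 1) (is_derive_cst p (0 : R) 1).
have [_ ] := is_deriveD h1 (is_derive_cst C (0 : R) 1).
by rewrite /cst scale1r scale0r !addr0.
Qed.

Lemma pair_shift (V V' : normedModType R) (h : R) (v : V) (v' : V') a a' :
  h *: (v, v') + (a, a') = (h *: v + a, h *: v' + a').
Proof. by []. Qed.

Variables phi1 phi2 psi : S -> 'rV[R]_8.

(** Serves both the cone, where psi is zero, and M. *)
Lemma frame_rows i x (r : R * R) : cdom (ch i) x ->
  (forall f, f = phi1 \/ f = phi2 \/ f = psi -> differentiable (loc i f) (coord (ch i) x)) ->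
  let D d f := 'D_d (loc i f) (coord (ch i) x) in
  let X := frame phi1 phi2 psi i (r, x) in
  [/\ row (inord 0) X = phi1 x, row (inord 1) X = phi2 x,
      row (inord 2) X = r.1 *: D ds phi1 + r.2 *: D ds phi2 + D ds psi &
      row (inord 3) X = r.1 *: D dt phi1 + r.2 *: D dt phi2 + D dt psi].
Proof.
move=> ix fd D X; set c := coord (ch i) x.
have d1 := fd _ (or_introl erefl); have d2 := fd _ (or_intror (or_introl erefl)).
have d3 := fd _ (or_intror (or_intror erefl)).
have rE k : (k < 4)%N -> row (inord k) X = 'D_((dir4 R)`_k) (iotaM_loc phi1 phi2 psi i) (r, c).
  by move=> k4; apply/rowP => j; rewrite !mxE inordK.
have base d : 'D_(0, d) (iotaM_loc phi1 phi2 psi i) (r, c) =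
    r.1 *: D d phi1 + r.2 *: D d phi2 + D d psi.
  rewrite (@derive_along _ _ _ _ _
    (fun y => r.1 *: loc i phi1 y + r.2 *: loc i phi2 y + loc i psi y) _ _ c d); last first.
    by move=> h; rewrite pair_shift scaler0 add0r.
  have e1 := derivableP (@diff_derivable _ _ _ _ _ d d1).
  have e2 := derivableP (@diff_derivable _ _ _ _ _ d d2).
  have e3 := derivableP (@diff_derivable _ _ _ _ _ d d3).
  by have [_ ->] := is_deriveD (is_deriveD (is_deriveZ r.1 e1) (is_deriveZ r.2 e2)) e3.
split; rewrite rE //=.
- rewrite (@derive_along _ _ _ _ _
    (fun h : R => h *: phi1 x + iotaM phi1 phi2 psi (r, x)) _ _ 0 1).
    exact: derive_affine.
  move=> h; rewrite pair_shift scaler0 add0r addr0 [h%:A]mulr1.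
  rewrite (surjective_pairing r) pair_shift scaler0 add0r [h%:A]mulr1.
  by rewrite /iotaM_loc /iotaM /= coordK // scalerDl !addrA.
- rewrite (@derive_along _ _ _ _ _
    (fun h : R => h *: phi2 x + iotaM phi1 phi2 psi (r, x)) _ _ 0 1).
    exact: derive_affine.
  move=> h; rewrite pair_shift scaler0 add0r addr0 [h%:A]mulr1.
  rewrite (surjective_pairing r) pair_shift scaler0 add0r [h%:A]mulr1.
  rewrite /iotaM_loc /iotaM /= coordK // scalerDl.
  by rewrite !addrA [h *: _ + _]addrC.
Qed.

(** If (al, be) = rho (cos theta, sin theta), the combination is rho times the first row of the
    Jacobian of [link] at the angle theta. *)
Lemma link_independent i x (al be : R) : link_immersion phi1 phi2 -> cdom (ch i) x ->
  differentiable (loc i phi1) (coord (ch i) x) ->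
  differentiable (loc i phi2) (coord (ch i) x) ->
  al *: 'D_ds (loc i phi1) (coord (ch i) x) + be *: 'D_ds (loc i phi2) (coord (ch i) x) = 0 ->
  (al, be) = 0.
Proof.
move=> im ix d1 d2 e; apply/eqP; apply: contraT => /polar_coordinates[rho [th [r0 aE bE]]].
have := row_free_row_neq0 (@Ordinal 3 0 isT) (im i x th ix); rewrite rowK /=.
rewrite (@derive_along _ _ _ _ _ (fun y => cos th *: loc i phi1 y + sin th *: loc i phi2 y)
  _ _ (coord (ch i) x) ds); last first.
  by move=> h; rewrite pair_shift scaler0 add0r.
have e1 := derivableP (@diff_derivable _ _ _ _ _ ds d1).
have e2 := derivableP (@diff_derivable _ _ _ _ _ ds d2).
have [_ ->] := is_deriveD (is_deriveZ (cos th) e1) (is_deriveZ (sin th) e2).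
move: e; rewrite aE bE -!scalerA -scalerDr => /eqP; rewrite scaler_eq0 (gt_eqF r0) /=.
by move=> ->.
Qed.

End Frames.

(** * The cone and the ruled 4-fold *)

Section LocalGeometry.
Variable R : realType.
Implicit Types x y v : 'rV[R]_8.

Lemma dotp_rowr x : linear_form (dotp x).
Proof. by move=> c u v; rewrite dotp_linear. Qed.
Lemma dotp_rowl x : linear_form (@dotp R ^~ x).
Proof. by move=> c u v; rewrite dotpDl dotpZl. Qed.
Lemma omega_rowr x : linear_form (omega x).
Proof. by move=> c u v; rewrite omega_linear. Qed.
Lemma omega_rowl x : linear_form (@omega R ^~ x).
Proof. by move=> c u v; rewrite omegaDl omegaZl. Qed.
Lemma Phi_row3 x y v : linear_form (fun z => Phi x y z v).
Proof. by move=> c u u'; rewrite PhiDm PhiZm. Qed.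
Lemma Phi_row2 x y v : linear_form (fun z => Phi x z y v).
Proof. by move=> c u u'; rewrite !(Phi_swap23 _ y) (Phi_row3 x y v); ring. Qed.
Lemma Phi_row1 x y v : linear_form (fun z => Phi z x y v).
Proof. by move=> c u u'; rewrite !(Phi_swap12 x) (Phi_row2 x y v); ring. Qed.

Variable U : set (R * R).
Hypothesis Uo : open U.

Lemma smooth_mixed n (f : R * R -> 'rV[R]_n) p : smooth_on U f -> U p ->
  'D_ds ('D_dt f) p = 'D_dt ('D_ds f) p.
Proof.
move=> fs Up; apply/rowP => j.
have nearU (Q : R * R -> Prop) : (forall z, U z -> Q z) -> \forall z \near p, Q z.
  by move=> UQ; apply: (filterS UQ); exact: open_nbhs_nbhs.
have co (g : R * R -> 'rV[R]_n) : smooth_on U g -> {for p, continuous (fun z => g z 0 j)}.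
  move=> gs; apply: differentiable_continuous.
  apply: (@differentiable_comp _ _ _ _ g (fun M : 'rV[R]_n => M 0 j)).
    exact: smooth_on_diff gs Up.
  exact: differentiable_coord.
have ss := smooth_on_derive fs (or_introl erefl : ds = ds \/ ds = dt).
have st := smooth_on_derive fs (or_intror erefl : dt = ds \/ dt = dt).
apply: esym.
apply: (@mixed_partials _ (fun z => f z 0 j) (fun z => 'D_ds f z 0 j) (fun z => 'D_dt f z 0 j)
  (fun z => 'D_dt ('D_ds f) z 0 j) (fun z => 'D_ds ('D_dt f) z 0 j)).
- by apply: nearU => z Uz; apply: is_derive_coord; exact: smooth_on_is_derive fs Uz.
- by apply: nearU => z Uz; apply: is_derive_coord; exact: smooth_on_is_derive fs Uz.
- by apply: nearU => z Uz; apply: is_derive_coord; exact: smooth_on_is_derive ss Uz.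
- by apply: nearU => z Uz; apply: is_derive_coord; exact: smooth_on_is_derive st Uz.
- by apply: co; apply: smooth_on_derive ss _; right.
- by apply: co; apply: smooth_on_derive st _; left.
Qed.

Lemma derive_on_eq (f g : R * R -> R) p d df dg : U p -> (forall z, U z -> f z = g z) ->
  is_derive p d f df -> is_derive p d g dg -> df = dg.
Proof.
move=> Up fg [_ <-] [_ <-]; apply: near_eq_derive.
exact: (open_near_eq Uo) fg Up.
Qed.

(** Testing against a fixed v turns the derivative of the triple cross product into the product rule
    for a trilinear form. *)
Lemma derive_cross (F G H K : R * R -> 'rV[R]_8) (c : R) p d :
  smooth_on U F -> smooth_on U G -> smooth_on U H -> smooth_on U K -> U p ->
  (forall z v, U z -> dotp (K z) v = c * Phi (F z) (G z) (H z) v) ->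
  forall v, dotp ('D_d K p) v = c * (Phi ('D_d F p) (G p) (H p) v
    + Phi (F p) ('D_d G p) (H p) v + Phi (F p) (G p) ('D_d H p) v).
Proof.
move=> Fs Gs Hs Ks Up e v.
have dK := is_derive_lin (dotp_rowl v) (smooth_on_is_derive d Ks Up).
have dT := is_derive_trilin (fun x y => @Phi_row3 x y v) (fun x y => @Phi_row2 x y v)
  (fun x y => @Phi_row1 x y v) (smooth_on_is_derive d Fs Up) (smooth_on_is_derive d Gs Up)
  (smooth_on_is_derive d Hs Up).
have dC := is_derive_fmul (is_derive_cst c p d) dT.
have := derive_on_eq Up (fun z Uz => e z v Uz) dK dC.
by rewrite mul0r add0r.
Qed.

Lemma derive_bilinear0 (T : 'rV[R]_8 -> 'rV[R]_8 -> R) (F G : R * R -> 'rV[R]_8) p d :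
  (forall u, linear_form (T u)) -> (forall u, linear_form (T^~ u)) ->
  smooth_on U F -> smooth_on U G -> U p ->
  (forall z, U z -> T (F z) (G z) = 0) -> T ('D_d F p) (G p) + T (F p) ('D_d G p) = 0.
Proof.
move=> T1 T2 Fs Gs Up e.
have dT := is_derive_bilin T1 T2 (smooth_on_is_derive d Fs Up) (smooth_on_is_derive d Gs Up).
exact: derive_on_eq Up e dT (is_derive_cst 0 p d).
Qed.

End LocalGeometry.

Section ConformalFrame.
Variables (R : realType) (S : riemannSurface R) (phi1 phi2 psi : S -> 'rV[R]_8).
Variables (i : idx S) (x : S) (r : R * R) (X2 X3 : 'rV[R]_8).
Hypotheses (ix : cdom (ch i) x) (pp : dotp (phi1 x) (phi1 x) = 1)
  (qq : dotp (phi2 x) (phi2 x) = 1) (pq : dotp (phi1 x) (phi2 x) = 0).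
Let X := frame phi1 phi2 psi i (r, x).
Hypotheses (row0 : row (inord 0) X = phi1 x) (row1 : row (inord 1) X = phi2 x)
  (row2 : row (inord 2) X = X2) (row3 : row (inord 3) X = X3).
Hypotheses
  (XY : forall v, dotp (phi1 x) v = 0 -> dotp (phi2 x) v = 0 ->
     dotp X3 v = Phi (phi1 x) (phi2 x) X2 v)
  (YX : forall v, dotp (phi1 x) v = 0 -> dotp (phi2 x) v = 0 ->
     dotp X2 v = - Phi (phi1 x) (phi2 x) X3 v).
Let m := dotp (reject (phi1 x) (phi2 x) X2) (reject (phi1 x) (phi2 x) X2).

Lemma det_frame : \det (X *m X^T) = m ^+ 2.
Proof. exact: (det_gram_conformal pp qq pq XY YX row0 row1 row2 row3). Qed.

Lemma regular_conformal : m != 0 -> regular phi1 phi2 psi (r, x).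
Proof.
by move=> m0; exists i => //; apply: row_free_gram; rewrite det_frame sqrf_eq0.
Qed.

(** Squaring removes the unknown sign of the orientation. *)
Lemma calibrated_conformal a : m != 0 -> calibrated_by phi1 phi2 psi a ->
  a (phi1 x) (phi2 x) X2 X3 ^+ 2 = m ^+ 2.
Proof.
move=> m0 [eps [[e1 _] /(_ i (r, x) ix (regular_conformal m0))]] /=.
rewrite -/X row0 row1 row2 row3 det_frame => ->.
rewrite exprMn sqr_sqrtr ?sqr_ge0 //.
by have [->|->] := e1 _ (regular_conformal m0); rewrite ?sqrrN expr1n mul1r.
Qed.

(** As m is nonnegative, the square root of m^2 is m itself: the sign is +1 for the order (r1, r2,
    s, t). *)
Lemma Cayley_conformal : Phi (phi1 x) (phi2 x) X2 X3 = Num.sqrt (\det (X *m X^T)).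
Proof.
rewrite det_frame sqrtr_sqr ger0_norm ?dotp_ge0 //.
by have [-> _ _] := conformal_frame pp qq pq XY YX.
Qed.

End ConformalFrame.

Section Cone.
Variables (R : realType) (S : riemannSurface R) (phi1 phi2 : S -> 'rV[R]_8).
Hypotheses (phi_framed : r_framing phi1 phi2) (phi_immersed : link_immersion phi1 phi2)
  (phi_SL : special_Lagrangian phi1 phi2 (fun=> 0)) (phi_flat : flat_gauge phi1 phi2).

Let s1 : smooth phi1. Proof. by case: phi_framed. Qed.
Let s2 : smooth phi2. Proof. by case: phi_framed. Qed.
Let pp x : dotp (phi1 x) (phi1 x) = 1. Proof. by have [_ _ /(_ x)[]] := phi_framed. Qed.
Let qq x : dotp (phi2 x) (phi2 x) = 1. Proof. by have [_ _ /(_ x)[]] := phi_framed. Qed.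
Let pq x : dotp (phi1 x) (phi2 x) = 0. Proof. by have [_ _ /(_ x)[]] := phi_framed. Qed.

Section AtChart.
Variable i : idx S.
Notation P := (loc i phi1).
Notation Q := (loc i phi2).
Let U := cimg i.
Let Uo : open U. Proof. exact: cimg_open. Qed.

Lemma flat_chart y : U y -> forall f, f = phi1 \/ f = phi2 ->
  (forall v, dotp ('D_dt (loc i f) y) v = Phi (P y) (Q y) ('D_ds (loc i f) y) v) /\
  (forall v, dotp ('D_ds (loc i f) y) v = - Phi (P y) (Q y) ('D_dt (loc i f) y) v).
Proof.
move=> Uy f fE; have [ix yE] := cimg_cinv Uy.
have [e1 e2] := phi_flat ix fE; rewrite yE in e1 e2.
by split=> v; [rewrite [in LHS]e1|rewrite [in LHS]e2 dotpNl]; rewrite crossP.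
Qed.

Lemma chart_independent y (al be : R) : U y ->
  al *: 'D_ds P y + be *: 'D_ds Q y = 0 -> (al, be) = 0.
Proof.
move=> Uy; have [ix yE] := cimg_cinv Uy; rewrite -yE.
apply: link_independent => //; rewrite yE.
  exact: smooth_on_diff (s1 i) Uy.
exact: smooth_on_diff (s2 i) Uy.
Qed.

Lemma chart_a_neq0 y : U y -> 'D_ds P y != 0.
Proof.
move=> Uy; apply/eqP => a0; have := @chart_independent y 1 0 Uy.
by rewrite a0 scaler0 scale0r addr0 => /(_ erefl) [/eqP]; rewrite oner_eq0.
Qed.

Lemma chart_b_neq0 y : U y -> 'D_ds Q y != 0.
Proof.
move=> Uy; apply/eqP => b0; have := @chart_independent y 0 1 Uy.
by rewrite b0 scaler0 scale0r addr0 => /(_ erefl) [/eqP]; rewrite oner_eq0.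
Qed.

(** On the cone the last two tangent vectors at r are a and Ja, already orthogonal to p and q and of
    equal length. Calibration is then the equality case of [calibrated_isotropic]; a nonzero a makes
    the point regular. *)
Lemma cone_isotropic y (r : R * R) : U y ->
  let a := r.1 *: 'D_ds P y + r.2 *: 'D_ds Q y in a != 0 ->
  [/\ omega (P y) (Q y) = 0, omega (P y) a = 0 & omega (Q y) a = 0].
Proof.
move=> Uy a a0; have [ix yE] := cimg_cinv Uy; set x := cinv (ch i) y in ix yE.
pose A := r.1 *: 'D_dt P y + r.2 *: 'D_dt Q y.
have [P1 P2] := flat_chart Uy (or_introl erefl).
have [Q1 Q2] := flat_chart Uy (or_intror erefl).
have A_ v : dotp A v = Phi (phi1 x) (phi2 x) a v.
  by rewrite -[phi1 x]/(P y) -[phi2 x]/(Q y) /A /a dotpDl !dotpZl PhiDm !PhiZm P1 Q1.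
have a_ v : dotp a v = - Phi (phi1 x) (phi2 x) A v.
  rewrite -[phi1 x]/(P y) -[phi2 x]/(Q y) /A /a dotpDl !dotpZl PhiDm !PhiZm P2 Q2.
  by rewrite !mulrN opprD.
have d0 d : 'D_d (loc i (fun=> 0 : 'rV[R]_8)) y = 0 by rewrite derive_cst.
have [||r0 r1 r2 r3] := @frame_rows _ _ phi1 phi2 (fun=> 0) i x r.
- by [].
- move=> f [->|[->|->]]; rewrite yE; [exact: smooth_on_diff (s1 i) Uy|
    exact: smooth_on_diff (s2 i) Uy|exact: differentiable_cst].
rewrite yE d0 addr0 -/a in r2; rewrite yE d0 addr0 -/A in r3.
move: a0 A_ a_ r2 r3; rewrite -[P y]/(phi1 x) -[Q y]/(phi2 x).
move: a A => a A a0 A_ a_ r2 r3.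
have pa : dotp (phi1 x) a = 0 by rewrite dotpC a_ Phi_repeat oppr0.
have qa : dotp (phi2 x) a = 0 by rewrite dotpC a_ Phi_repeat oppr0.
have rej : reject (phi1 x) (phi2 x) a = a by rewrite /reject pa qa !scale0r !subr0.
have AA : dotp A A = dotp a a by rewrite A_ a_ Phi_swap34.
have aa := dotp_gt0 a0.
have XY v : dotp (phi1 x) v = 0 -> dotp (phi2 x) v = 0 ->
    dotp A v = Phi (phi1 x) (phi2 x) a v.
  by move=> _ _; exact: A_.
have YX v : dotp (phi1 x) v = 0 -> dotp (phi2 x) v = 0 ->
    dotp a v = - Phi (phi1 x) (phi2 x) A v.
  by move=> _ _; exact: a_.
have := calibrated_conformal ix (pp x) (qq x) (pq x) r0 r1 r2 r3 XY YX _ phi_SL.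
rewrite rej => /(_ (lt0r_neq0 aa)) e.
apply: (@calibrated_isotropic _ _ _ _ A) => //; first by rewrite AA.
by rewrite AA e expr2.
Qed.

Lemma chart_isotropic_frame y : U y ->
  isotropic_frame (P y) (Q y) ('D_ds P y) ('D_ds Q y) ('D_dt P y) ('D_dt Q y).
Proof.
move=> Uy; have [P1 P2] := flat_chart Uy (or_introl erefl).
have [Q1 Q2] := flat_chart Uy (or_intror erefl).
(* The points (1, 0) and (0, 1) of the ruling plane have p_s and q_s as tangent vectors. *)
have := @cone_isotropic y (1, 0) Uy; rewrite /= scale1r scale0r addr0.
move=> /(_ (chart_a_neq0 Uy))[w1 w2 w3].
have := @cone_isotropic y (0, 1) Uy; rewrite /= scale1r scale0r add0r.
by move=> /(_ (chart_b_neq0 Uy))[_ w4 w5]; split=> //; [exact: pp|exact: qq|exact: pq].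
Qed.

(* Differentiating g(p, q_s) = g(p, q_t) = 0 gives g(p_t, q_s) = g(p_s, q_t), and J
   is skew. *)
Lemma chart_dot_Ab y : U y -> dotp ('D_dt P y) ('D_ds Q y) = 0.
Proof.
move=> Uy; have sQs := smooth_on_derive (s2 i) (or_introl erefl : ds = ds \/ ds = dt).
have sQt := smooth_on_derive (s2 i) (or_intror erefl : dt = ds \/ dt = dt).
have e1 := derive_bilinear0 Uo dt (@dotp_rowr R) (@dotp_rowl R) (s1 i) sQs Uy
  (fun z Uz => (iso_dot0b (chart_isotropic_frame Uz)).1.1.1.1).
have e2 := derive_bilinear0 Uo ds (@dotp_rowr R) (@dotp_rowl R) (s1 i) sQt Uy
  (fun z Uz => (iso_dot0b (chart_isotropic_frame Uz)).1.1.2).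
rewrite (smooth_mixed Uo (s2 i) Uy) in e2.
have fr := chart_isotropic_frame Uy.
have e3 : dotp ('D_dt Q y) ('D_ds P y) = - dotp ('D_dt P y) ('D_ds Q y).
  rewrite (iso_B fr) (iso_A fr); exact: Phi_swap34.
rewrite dotpC in e2; move: e1 e2 e3.
move: (dotp _ _) (dotp _ _) (dotp _ _) => c1 c2 c3 e1 e2 e3; lra.
Qed.

Variable w : tangent_field S.
Hypothesis w_holo : holomorphic_vector_field w.
Notation psi := (psi_field w phi1 phi2).

Lemma psi_conformal y : U y ->
  (forall v, dotp (P y) v = 0 -> dotp (Q y) v = 0 ->
    dotp ('D_dt (loc i psi) y) v = Phi (P y) (Q y) ('D_ds (loc i psi) y) v) /\
  (forall v, dotp (P y) v = 0 -> dotp (Q y) v = 0 ->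
    dotp ('D_ds (loc i psi) y) v = - Phi (P y) (Q y) ('D_dt (loc i psi) y) v).
Proof.
move=> Uy; have fr := chart_isotropic_frame Uy; have a0 := chart_a_neq0 Uy.
have [cr1 cr2] := cauchy_riemann w_holo Uy.
have [_ E1] := is_derive_psi w_holo s1 s2 ds Uy.
have [_ E2] := is_derive_psi w_holo s1 s2 dt Uy.
have sP d : d = ds \/ d = dt -> smooth_on U ('D_d P) by exact: smooth_on_derive (s1 i).
have sQ d : d = ds \/ d = dt -> smooth_on U ('D_d Q) by exact: smooth_on_derive (s2 i).
have sPs := sP ds (or_introl erefl); have sPt := sP dt (or_intror erefl).
have sQs := sQ ds (or_introl erefl); have sQt := sQ dt (or_intror erefl).
have F1 f : f = phi1 \/ f = phi2 -> forall z v, U z ->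
    dotp ('D_dt (loc i f) z) v = 1 * Phi (P z) (Q z) ('D_ds (loc i f) z) v.
  by move=> fE z v Uz; rewrite mul1r; have [-> _] := flat_chart Uz fE.
have F2 f : f = phi1 \/ f = phi2 -> forall z v, U z ->
    dotp ('D_ds (loc i f) z) v = -1 * Phi (P z) (Q z) ('D_dt (loc i f) z) v.
  by move=> fE z v Uz; rewrite mulN1r; have [_ ->] := flat_chart Uz fE.
have P1 d := derive_cross Uo d (s1 i) (s2 i) sPs sPt Uy (F1 _ (or_introl erefl)).
have P2 d := derive_cross Uo d (s1 i) (s2 i) sPt sPs Uy (F2 _ (or_introl erefl)).
have Q1 d := derive_cross Uo d (s1 i) (s2 i) sQs sQt Uy (F1 _ (or_intror erefl)).
have Q2 d := derive_cross Uo d (s1 i) (s2 i) sQt sQs Uy (F2 _ (or_intror erefl)).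
have mP := smooth_mixed Uo (s1 i) Uy; have mQ := smooth_mixed Uo (s2 i) Uy.
exact: (ruled_derivative_conformal fr a0 cr1 cr2 mP mQ E1 E2
  (P1 ds) (P1 dt) (Q1 ds) (Q1 dt) (P2 ds) (P2 dt) (Q2 ds) (Q2 dt)).
Qed.

End AtChart.
End Cone.

Section Ruled.
Variables (R : realType) (S : riemannSurface R) (phi1 phi2 : S -> 'rV[R]_8).
Hypotheses (phi_framed : r_framing phi1 phi2) (phi_immersed : link_immersion phi1 phi2)
  (phi_SL : special_Lagrangian phi1 phi2 (fun=> 0)) (phi_flat : flat_gauge phi1 phi2).
Variable w : tangent_field S.
Hypothesis w_holo : holomorphic_vector_field w.
Notation psi := (psi_field w phi1 phi2).

Let s1 : smooth phi1. Proof. by case: phi_framed. Qed.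
Let s2 : smooth phi2. Proof. by case: phi_framed. Qed.
Let s3 : smooth psi. Proof. exact: smooth_psi. Qed.
Let pp x : dotp (phi1 x) (phi1 x) = 1. Proof. by have [_ _ /(_ x)[]] := phi_framed. Qed.
Let qq x : dotp (phi2 x) (phi2 x) = 1. Proof. by have [_ _ /(_ x)[]] := phi_framed. Qed.
Let pq x : dotp (phi1 x) (phi2 x) = 0. Proof. by have [_ _ /(_ x)[]] := phi_framed. Qed.

Definition partial_at (d : R * R) (i : idx S) (x : S) (f : S -> 'rV[R]_8) : 'rV[R]_8 :=
  'D_d (loc i f) (coord (ch i) x).

Definition ruled_tangent d i x (r : R * R) : 'rV[R]_8 :=
  r.1 *: partial_at d i x phi1 + r.2 *: partial_at d i x phi2 + partial_at d i x psi.

Section AtPoint.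
Variables (i : idx S) (x : S).
Hypothesis ix : cdom (ch i) x.
Let y := coord (ch i) x.
Let Uy : cimg i y. Proof. by exists x. Qed.
Let locE (f : S -> 'rV[R]_8) : loc i f y = f x.
Proof. by rewrite /loc /y /= coordK. Qed.

Lemma frame_at : isotropic_frame (phi1 x) (phi2 x)
  (partial_at ds i x phi1) (partial_at ds i x phi2)
  (partial_at dt i x phi1) (partial_at dt i x phi2).
Proof.
have := chart_isotropic_frame phi_framed phi_immersed phi_SL phi_flat Uy.
by rewrite !locE.
Qed.

Lemma partial_phi1_neq0 : partial_at ds i x phi1 != 0.
Proof. exact: (chart_a_neq0 phi_framed phi_immersed Uy). Qed.

Lemma ruled_rows (r : R * R) (X := frame phi1 phi2 psi i (r, x)) :
  [/\ row (inord 0) X = phi1 x, row (inord 1) X = phi2 x,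
      row (inord 2) X = ruled_tangent ds i x r & row (inord 3) X = ruled_tangent dt i x r].
Proof.
apply: (@frame_rows _ _ phi1 phi2 psi i x r ix) => f [->|[->|->]].
- exact: smooth_on_diff (s1 i) Uy.
- exact: smooth_on_diff (s2 i) Uy.
- exact: smooth_on_diff (s3 i) Uy.
Qed.

Lemma ruled_conformal (r : R * R) :
  (forall v, dotp (phi1 x) v = 0 -> dotp (phi2 x) v = 0 ->
    dotp (ruled_tangent dt i x r) v = Phi (phi1 x) (phi2 x) (ruled_tangent ds i x r) v) /\
  (forall v, dotp (phi1 x) v = 0 -> dotp (phi2 x) v = 0 ->
    dotp (ruled_tangent ds i x r) v = - Phi (phi1 x) (phi2 x) (ruled_tangent dt i x r) v).
Proof.
have [c1 c2] : (forall v, dotp (phi1 x) v = 0 -> dotp (phi2 x) v = 0 ->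
    dotp (partial_at dt i x psi) v = Phi (phi1 x) (phi2 x) (partial_at ds i x psi) v) /\
  (forall v, dotp (phi1 x) v = 0 -> dotp (phi2 x) v = 0 ->
    dotp (partial_at ds i x psi) v = - Phi (phi1 x) (phi2 x) (partial_at dt i x psi) v).
  have := psi_conformal phi_framed phi_immersed phi_SL phi_flat w_holo Uy.
  by rewrite !locE.
have [_ _ _ A_ a_ B_ b_ _ _ _ _ _] := frame_at.
rewrite /ruled_tangent; move: c1 c2 A_ a_ B_ b_.
move: (partial_at ds i x psi) (partial_at dt i x psi)
  (partial_at ds i x phi1) (partial_at dt i x phi1)
  (partial_at ds i x phi2) (partial_at dt i x phi2) => ps pt a A b B c1 c2 A_ a_ B_ b_.
split=> v pv qv; rewrite !(dotpDl, dotpZl) !(PhiDm, PhiZm).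
  by rewrite A_ B_ c1.
by rewrite a_ b_ c2 // !mulrN !opprD.
Qed.

(* The square root of the Gram determinant of the frame. *)
Definition ruled_density (r : R * R) : R :=
  let X := reject (phi1 x) (phi2 x) (ruled_tangent ds i x r) in dotp X X.

(* A ruling plane contains at most one singular point. *)
Lemma ruled_density_shift (r : R * R) (e : R) : e != 0 ->
  ruled_density r != 0 \/ ruled_density (r.1 + e, r.2) != 0.
Proof.
move=> e0; have [|] := eqVneq (ruled_density r) 0; last by left.
move=> /dotp_eq0 r0; right; apply/eqP => /dotp_eq0 r1.
have fr := frame_at; have := partial_phi1_neq0; apply/negP; rewrite negbK.
suff : e *: partial_at ds i x phi1 = 0 by move=> /eqP; rewrite scaler_eq0 (negbTE e0).
(* The shift adds e p_s, which is orthogonal to p and q and so equals its own rejection. *)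
have tE : ruled_tangent ds i x (r.1 + e, r.2) =
    ruled_tangent ds i x r + e *: partial_at ds i x phi1.
  rewrite /ruled_tangent.
  move: (partial_at _ _ _ _) (partial_at _ _ _ _) (partial_at _ _ _ _) => *.
  by apply/rowP => j; rewrite !mxE /=; ring.
have rejD (p q u v : 'rV[R]_8) : reject p q (u + v) = reject p q u + reject p q v.
  by rewrite /reject !dotpDr; apply/rowP => j; rewrite !mxE; ring.
have : reject (phi1 x) (phi2 x) (e *: partial_at ds i x phi1) = 0.
  by move: r1; rewrite tE rejD r0 add0r.
by rewrite {1}/reject !dotpZr !(iso_dot0 fr) !mulr0 !scale0r !subr0.
Qed.

Lemma ruled_regular (r : R * R) : ruled_density r != 0 -> regular phi1 phi2 psi (r, x).
Proof.
have [r0 r1 r2 r3] := ruled_rows r; have [XY YX] := ruled_conformal r.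
exact: (regular_conformal ix (pp x) (qq x) (pq x) r0 r1 r2 r3 XY YX).
Qed.

Lemma ruled_Cayley (r : R * R) (X := frame phi1 phi2 psi i (r, x)) :
  Phi (row (inord 0) X) (row (inord 1) X) (row (inord 2) X) (row (inord 3) X)
  = Num.sqrt (\det (X *m X^T)).
Proof.
have [r0 r1 r2 r3] := ruled_rows r; have [XY YX] := ruled_conformal r.
rewrite {1 2 3 4}/X r0 r1 r2 r3.
exact: (Cayley_conformal (pp x) (qq x) (pq x) r0 r1 r2 r3 XY YX).
Qed.

(** One regular point on the ruling over x suffices: p_s and q_s are omega-orthogonal to p and q, so
    r drops out of omega(p, X_s) and omega(q, X_s). *)
Lemma special_Lagrangian_zero_at : special_Lagrangian phi1 phi2 psi -> w i x = 0.
Proof.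
move=> SL; have fr := frame_at.
(* One of the points (0, 0) and (1, 0) of the plane is regular. *)
have [r m0] : exists r, ruled_density r != 0.
  by have [|] := @ruled_density_shift 0 1 (oner_neq0 _); [exists 0|exists (0 + 1, 0)].
have [r0 r1 r2 r3] := ruled_rows r; have [XY YX] := ruled_conformal r.
have e := calibrated_conformal ix (pp x) (qq x) (pq x) r0 r1 r2 r3 XY YX m0 SL.
have [wpq wp wq] := conformal_isotropic (pp x) (qq x) (pq x) XY YX m0 e.
have wtan f : omega f (partial_at ds i x phi1) = 0 -> omega f (partial_at ds i x phi2) = 0 ->
    omega f (ruled_tangent ds i x r) = 0 -> omega f (partial_at ds i x psi) = 0.
  rewrite /ruled_tangent.
  move: (partial_at _ _ _ _) (partial_at _ _ _ _) (partial_at _ _ _ _) => X Y Z f1 f2.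
  by rewrite !(omegaDr, omegaZr) f1 f2 !mulr0 !add0r.
have wps : omega (phi1 x) (partial_at ds i x psi) = 0.
  apply: wtan; [exact: iso_wpa fr|exact: iso_wpb fr|].
  by rewrite -wp omega_reject // omega_id.
have wqs : omega (phi2 x) (partial_at ds i x psi) = 0.
  apply: wtan; [exact: iso_wqa fr|exact: iso_wqb fr|].
  by rewrite -wq omega_reject // ?omega_id // omegaC wpq oppr0.
have Uo : open (cimg i) by exact: cimg_open.
(* The formula for psi in terms of p_s, p_t, q_s, q_t gives this on the whole chart, so it may be
   differentiated at y. *)
have wpsi z : cimg i z -> omega (loc i phi1 z) (loc i psi z) = 0 /\
    omega (loc i phi2 z) (loc i psi z) = 0.
  move=> Uz; have fz := chart_isotropic_frame phi_framed phi_immersed phi_SL phi_flat Uz.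
  rewrite (psi_chartE w_holo s1 s2 Uz); exact: isotropic_combination fz.
have addl_eq0 (c d : R) : c + d = 0 -> d = 0 -> c = 0 by move=> + d0; rewrite d0 addr0.
have wa : omega (partial_at ds i x phi1) (psi x) = 0.
  have := derive_bilinear0 Uo ds (@omega_rowr R) (@omega_rowl R) (s1 i) (s3 i) Uy
    (fun z Uz => (wpsi z Uz).1).
  by rewrite !locE => h; exact: addl_eq0 h wps.
have wb : omega (partial_at ds i x phi2) (psi x) = 0.
  have := derive_bilinear0 Uo ds (@omega_rowr R) (@omega_rowl R) (s2 i) (s3 i) Uy
    (fun z Uz => (wpsi z Uz).2).
  by rewrite !locE => h; exact: addl_eq0 h wqs.
have Ab : dotp (partial_at dt i x phi1) (partial_at ds i x phi2) = 0.
  exact: (chart_dot_Ab phi_framed phi_immersed phi_SL phi_flat Uy).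
have psiE : psi x = (w i x).1 *: partial_at ds i x phi1 + (w i x).2 *: partial_at dt i x phi1
    - (w i x).2 *: partial_at ds i x phi2 + (w i x).1 *: partial_at dt i x phi2.
  have := psi_chartE w_holo s1 s2 Uy; rewrite locE => ->.
  by rewrite /psi_chart /wu /wv /loc /= coordK.
have ind al be := @chart_independent _ _ _ _ phi_framed phi_immersed i y al be Uy.
rewrite psiE in wa wb.
rewrite [w i x]surjective_pairing.
exact: (isotropic_coefficients_eq0 fr partial_phi1_neq0 Ab ind wa wb).
Qed.

End AtPoint.
End Ruled.

(** * Components of the surface and the theorem *)

Section Global.
Variables (R : realType) (S : riemannSurface R) (phi1 phi2 : S -> 'rV[R]_8).

(** A short segment in the s direction of a chart is connected, so it lies in the component. Hence
    cos theta p_s + sin theta q_s = 0 at x, and independence would force cos theta = sin theta =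
    0. *)
Lemma component_not_constant (x : S) (theta : R) (c : 'rV[R]_8) :
  r_framing phi1 phi2 -> link_immersion phi1 phi2 ->
  ~ (forall z, connected_component [set: S] x z ->
       cos theta *: phi1 z + sin theta *: phi2 z = c).
Proof.
move=> fr im cst; have [i ix] := ch_cover x.
have [s1 s2 _] := fr.
set y := coord (ch i) x; have Uy : cimg i y by exists x.
have Uo : open (cimg i) by exact: cimg_open.
have /nbhs_ballP[e /= e0 eU] : nbhs y (cimg i) by exact: open_nbhs_nbhs.
have seg (h : R) : `|h| < e -> cimg i (h *: ds + y).
  move=> he; have -> : h *: ds + y = (h + y.1, y.2).
    by rewrite [y in LHS]surjective_pairing pair_shift scaler0 add0r [h%:A]mulr1.
  apply: eU; split; rewrite /ball /=; last by rewrite subrr normr0.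
  by rewrite opprD addrCA subrr addr0 normrN.
pose g (h : R) : S := cinv (ch i) (h *: ds + y).
have gK h : `|h| < e -> connected_component [set: S] x (g h).
  move=> he; apply: (@connected_component_max _ _ (g @` `]-e, e[)) => //.
  - exists 0; first by rewrite /= in_itv /= oppr_lt0 e0.
    by rewrite /g scale0r add0r coordK.
  - apply: connected_continuous_connected.
      by apply/connected_intervalP; exact: interval_is_interval.
    apply: continuous_in_subspaceT => k /set_mem /=; rewrite in_itv /= -ltr_norml => ke.
    apply: (@continuous_comp _ _ _ (fun h : R => h *: ds + y) (cinv (ch i))).
      apply: cvgD; last exact: cvg_cst.
      by apply: cvgZr_tmp; exact: cvg_id.
    by apply: cinv_cont; exact: seg.
  - by exists h => //=; rewrite in_itv /= -ltr_norml.
have d1 := smooth_on_is_derive ds (s1 i) Uy; have d2 := smooth_on_is_derive ds (s2 i) Uy.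
have [_ D] := is_deriveD (is_deriveZ (cos theta) d1) (is_deriveZ (sin theta) d2).
have D0 : 'D_ds (cos theta \*: loc i phi1 + sin theta \*: loc i phi2) y = 0.
  rewrite (@derive_along _ _ _ _ _
    (fun h : R => cos theta *: phi1 (g h) + sin theta *: phi2 (g h))
    _ _ 0 1); last by move=> h; rewrite /g addr0 [h%:A]mulr1.
  transitivity ('D_1 (fun _ : R => c) 0); last exact: derive_cst.
  apply: near_eq_derive.
  have : \forall h \near (0 : R), `|h| < e by exact: nbhs0_lt.
  by apply: filterS => h he; apply: cst; exact: gK.
have [/eqP c0 /eqP s0] := chart_independent fr im Uy (etrans (esym D) D0).
have := cos2Dsin2 theta; rewrite (eqP c0) (eqP s0) expr0n /= addr0 => /eqP.
by rewrite eq_sym oner_eq0.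
Qed.

End Global.

Theorem theorem4p11 (R : realType) (Sigma : riemannSurface R)
    (phi1 phi2 : Sigma -> 'rV[R]_8) (w : tangent_field Sigma)
    (M0 := [set y | exists (r1 r2 : R) (x : Sigma),
              y = r1 *: phi1 x + r2 *: phi2 x])
    (psi := fun x : Sigma => Lie w phi1 x + Lie (imul w) phi2 x)
    (M := [set y | exists (r1 r2 : R) (x : Sigma),
             y = r1 *: phi1 x + r2 *: phi2 x + psi x])
    (M0_cone : rframed_2ruled_cone phi1 phi2 M0)
    (M0_SL : special_Lagrangian phi1 phi2 (fun=> 0))
    (phi_flat : flat_gauge phi1 phi2)
    (w_holo : holomorphic_vector_field w) :
  rframed_2ruled_4fold phi1 phi2 psi M /\
  Cayley phi1 phi2 psi /\
  (special_Lagrangian phi1 phi2 psi <->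
     zero_field w \/
     forall K : set Sigma, component K ->
       exists theta : R, exists c : 'rV[R]_8,
         forall x, K x -> cos theta *: phi1 x + sin theta *: phi2 x = c).
Proof.
have [fr _ im] := M0_cone; have [s1 s2 _] := fr.
split; [split=> //|split].
- exact: (smooth_psi w_holo s1 s2).
- apply/seteqP; split=> [y [r1 [r2 [x ->]]]|y [[[r1 r2] x] _ <-]].
    by exists ((r1, r2), x).
  by exists r1, r2, x.
(* It is enough to move inside the ruling plane of x: one of r and its translate by e / 2 is
   regular. *)
- move=> O [[r x] Orx] Oo; have [i ix] := ch_cover x.
  have : \forall r' \near r, O (r', x).
    have [[A B] /= [nA nB] AB] : nbhs (r, x) O by exact: open_nbhs_nbhs.
    by apply: filterS nA => r' Ar'; apply: AB; split=> //=; exact: nbhs_singleton.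
  move=> /nbhs_ballP[e /= e0 eO].
  have h0 : e / 2 != 0 by rewrite gt_eqF // divr_gt0.
  have [m0|m0] := ruled_density_shift fr im M0_SL phi_flat w ix r h0.
    by exists (r, x); split=> //; exact: ruled_regular m0.
  exists ((r.1 + e / 2, r.2), x); split; last exact: ruled_regular m0.
  apply: eO; split; rewrite /ball /=.
    rewrite opprD addrA subrr sub0r normrN gtr0_norm ?divr_gt0 // gtr_pMr //.
    by rewrite invf_lt1 // ltr1n.
  by rewrite subrr normr0.
- exists (fun=> 1); split.
    by split; [left|apply: continuous_subspaceT; exact: cst_continuous].
  move=> i [r x] ix _ /=; rewrite mul1r.
  exact: (ruled_Cayley fr im M0_SL phi_flat w_holo ix).
(* For w = 0 also psi = 0, and the claim is that the cone is special Lagrangian. *)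
have zeroSL : zero_field w -> special_Lagrangian phi1 phi2 psi.
  move=> w0; suff -> : psi = fun=> 0 by [].
  apply/funext => x; rewrite /psi /Lie; set i := chart_at x.
  have ix : cdom (ch i) x by rewrite /i /chart_at; case: cid.
  by rewrite /imul (w0 i x ix) /= oppr0 !derive0 addr0.
split=> [SL|[//|const]].
  by left=> i x ix; exact: (special_Lagrangian_zero_at fr im M0_SL phi_flat w_holo ix SL).
(* The vanishing of w is claimed point by point, and each point contradicts the constancy on its own
   component; an empty surface is thereby covered. *)
apply: zeroSL => i x ix; exfalso.
have [theta [c cst]] := const _ (ex_intro _ x erefl).
exact: component_not_constant fr im cst.
Qed.
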